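(* Consider the dynamic programming equation $$R(k,X,n)=\min\bigl(R_1(k,X,n),R_2(k,X,n)\bigr),$$ where $k,n$ are nonnegative multiples of $M$ with $k+n\le N$, $R_1(k,X,n)=R_2(k,X,n)=0$ for $k+n=N$, and $$R_1(k,X,n)=M g_1(X,n)+R(k+M,X,n),$$ $$R_2(k,X,n)=M g_2(X,n)+R(k,X,n+M)*f_{MD}(X)$$ for $0\le k+n<N$. Here $$g_1(X,n)=\int_0^C m\exp\left(D^{-1}(Xm-0.5\,nm^2)\right)\lambda(m)\,dm,$$ $$g_2(X,n)=\int_{-C}^0|m|\exp\left(D^{-1}(Xm-0.5\,nm^2)\right)\lambda(m)\,dm.$$ Then the Bayesian risk (over strategies that process the data in batches of size $M$) is $$R^B_N(\lambda)=R(0,0,0).$$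
   Context: Gaussian densities: for a variance $V>0$, $f_V(x|a)=(2\pi V)^{-1/2}\exp\{-(x-a)^2/(2V)\}$ and $f_V(x)=f_V(x|0)$. Convolution is taken in the $X$ variable: $F(x)*G(x)=\int_{-\infty}^{\infty}F(x-y)G(y)\,dy$. Gaussian one-armed bandit: fix $D>0$, $0<C<\infty$ and positive integers $N,M$ with $N$ a multiple of $M$. At each step $i=1,\dots,N$ an action $y_i\in\{1,2\}$ is chosen and a random income $\xi_i$ depending only on the current action is received. If $y_i=2$, $\xi_i$ has density $f_D(x|m)$ with $D$ known and $m$ unknown; if $y_i=1$, $\xi_i$ has a known distribution with expectation $0$. The parameter is $\theta=(0,m)$, with $\Theta=\{\theta=(0,m):|m|\le C\}$. Strategies: the history is described by $(k,X,n)$, where $k,n$ are the numbers of past applications of the first and the second action and $X$ is the cumulative income from the second action ($X=0$ if $n=0$). A strategy $\sigma$ assigns to each history a (possibly randomized) selection of the next action, and only strategies that may change the action after applying it $M$ times in succession are used: a selection is made when $k,n$ are multiples of $M$ and the selected action is used for the next $M$ steps. Loss: $L_N(\sigma,\theta)=N\max(0,m)-\mathrm{E}_{\sigma,\theta}\bigl(\sum_{i=1}^N\xi_i\bigr)$. Prior: $\lambda$ is a probability density of $m$ on $[-C,C]$ with $\int_{-C}^0|m|\lambda(m)\,dm>0$ and $\int_0^C m\lambda(m)\,dm>0$. Bayesian risk: $R^B_N(\lambda)=\min_{\sigma}\int_{-C}^{C}L_N(\sigma,(0,m))\,\lambda(m)\,dm$. *)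

(* Defs.v *)
From HB Require Import structures.
From mathcomp Require Import all_boot all_order all_algebra.
From mathcomp Require Import all_classical all_reals all_analysis.
From mathcomp Require Import measurable_realfun.
Set Implicit Arguments.
Unset Strict Implicit.
Unset Printing Implicit Defensive.
Import Order.TTheory GRing.Theory Num.Theory.
Import numFieldNormedType.Exports.
Local Open Scope classical_set_scope.
Local Open Scope ring_scope.

Definition gauss_pdf (R : realType) (V a x : R) : R :=
  normal_pdf a (Num.sqrt V) x.

Definition convolution (R : realType) (F : R -> \bar R) (G : R -> R) (x : R)
    : \bar R :=
  (\int[lebesgue_measure]_y (F (x - y)%R * (G y)%:E))%E.

(* The second marginal of P (dx) k(x, dy), as a probability measure. *)
Section probability_bind.
Context d1 d2 (T1 : measurableType d1) (T2 : measurableType d2) (R : realType).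
Variables (P : probability T1 R) (k : R.-pker T1 ~> T2).
Local Open Scope ereal_scope.

Definition probability_bind (A : set T2) : \bar R := \int[P]_x k x A.

Let bind0 : probability_bind set0 = 0.
Proof. by apply: integral0_eq => x _; rewrite measure0. Qed.

Let bind_ge0 A : 0 <= probability_bind A.
Proof. exact: integral_ge0. Qed.

Let bind_sigma_additive : semi_sigma_additive probability_bind.
Proof.
move=> U mU tU mUU; rewrite [X in _ --> X](_ : _ =
  \int[P]_x (\sum_(n <oo) k x (U n))); last first.
  apply: eq_integral => x _.
  by apply/esym/cvg_lim => //; exact/measure_semi_sigma_additive.
apply/cvg_closeP; split.
  by apply: is_cvg_nneseries => n _ _; exact: integral_ge0.
rewrite closeE// integral_nneseries// => n.
exact: measurable_kernel.
Qed.

HB.instance Definition _ := isMeasure.Build _ _ R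
  probability_bind bind0 bind_ge0 bind_sigma_additive.

Let bind_setT : probability_bind [set: T2] = 1.
Proof.
rewrite /probability_bind; under eq_integral do rewrite prob_kernel.
by rewrite integral_cst// mul1e; exact: probability_setT.
Qed.

HB.instance Definition _ :=
  @Measure_isProbability.Build _ _ R probability_bind bind_setT.

End probability_bind.

(* Actions are booleans: [false] is the first action (known income
   distribution), [true] is the second one. A trajectory is the sequence of
   pairs (action, income), the most recent step first. *)
Section trajectories.
Context (R : realType).
Implicit Type h : seq (bool * R).

Definition uses1 h : nat := count (fun z => ~~ z.1) h.
Definition uses2 h : nat := count (fun z => z.1) h.
Definition income2 h : R := \sum_(z <- h | z.1) z.2.
Definition total_income h : R := \sum_(z <- h) z.2.

End trajectories.

(* [select2 k X n] is the probability of selecting the second action. *)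
Record strategy (R : realType) := Strategy {
  select2 : nat -> R -> nat -> R ;
  select2_bounds : forall k X n, 0 <= select2 k X n <= 1 ;
  measurable_select2 : forall k n,
    measurable_fun [set: R] (fun X => select2 k X n) }.

(* Probability that the action following trajectory h is the second one: a new
   selection is made at batch boundaries, otherwise the last action is
   repeated. *)
Definition next_action2 (R : realType) (M : nat) (sigma : strategy R)
    (h : seq (bool * R)) : R :=
  if (M %| uses1 h)%N && (M %| uses2 h)%N
  then select2 sigma (uses1 h) (income2 h) (uses2 h)
  else ((head (false, 0) h).1)%:R.

Section trajectory_law.
Context (R : realType) (M : nat) (D : R).
Local Notation TR := (measurableTypeR R).
Variable mu1 : probability TR R.
Variables (sigma : strategy R) (m : R).

Definition income_prob (a : bool) : probability TR R :=
  if a then (normal_prob m (Num.sqrt D) : probability TR R) else mu1.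

Let measurable_last i : measurable_fun [set: i.-tuple (bool * TR)]
  (fun h => ((head (false, 0) h).1)%:R : R).
Proof.
case: i => [|i].
  rewrite (_ : (fun _ => _) = cst 0) //.
  by apply/funext => h; rewrite tuple0.
rewrite (_ : (fun _ => _) = (fun h : i.+1.-tuple (bool * TR) =>
  if (tnth h ord0).1 then 1 else 0)).
  apply: measurable_fun_ifT => //.
  by apply: measurableT_comp; [exact: measurable_fst|exact: measurable_tnth].
apply/funext => h.
by rewrite (tnth_nth (false, 0)) nth0; case: (head _ _).1.
Qed.

Section step.
Variable i : nat.
Local Open Scope ereal_scope.

Definition extend (h : i.-tuple (bool * TR)) (z : bool * TR)
    : i.+1.-tuple (bool * TR) := [the i.+1.-tuple (bool * TR) of z :: h].

Definition step_prob (h : i.-tuple (bool * TR))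
    (A : set (i.+1.-tuple (bool * TR))) : \bar R :=
  \int[bernoulli_prob (next_action2 M sigma h)]_a
    income_prob a [set x | A (extend h (a, x))].

Lemma measurable_extend (a : bool) :
  measurable_fun [set: i.-tuple (bool * TR) * TR]
    (fun z => extend z.1 (a, z.2)).
Proof.
apply: measurable_cons => //.
by apply: measurable_fun_pair => //; exact: measurable_snd.
Qed.

Let measurable_section (h : i.-tuple (bool * TR)) a A : measurable A ->
  measurable [set x : TR | A (extend h (a, x))].
Proof.
move=> mA.
have mf : measurable_fun [set: TR] (fun x => extend h (a, x)).
  apply: measurable_cons => //; exact: measurable_fun_pair.
by rewrite -[X in measurable X]setTI; exact: mf.
Qed.

Let step0 h : step_prob h set0 = 0.
Proof.
apply: integral0_eq => a _; rewrite (_ : [set x | _] = set0) ?measure0//.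
Qed.

Let step_ge0 h A : 0 <= step_prob h A.
Proof. by apply: integral_ge0 => a _; exact: measure_ge0. Qed.

Let step_sigma_additive h : semi_sigma_additive (step_prob h).
Proof.
move=> U mU tU mUU; rewrite [X in _ --> X](_ : _ =
  \int[bernoulli_prob (next_action2 M sigma h)]_a
    (\sum_(n <oo) income_prob a [set x | U n (extend h (a, x))])); last first.
  apply: eq_integral => a _; apply/esym/cvg_lim => //.
  rewrite (_ : [set x | _] =
    \bigcup_n [set x | U n (extend h (a, x))]); last by [].
  apply: measure_semi_sigma_additive.
  - by move=> n; exact: measurable_section.
  - apply/trivIsetP => p q _ _ pq; apply/seteqP; split => // x [/= Up Uq].
    move/trivIsetP : tU => /(_ p q Logic.I Logic.I pq) => UU.
    by rewrite -[False]/(set0 (extend h (a, x))) -UU.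
  - by apply: bigcup_measurable => n _; exact: measurable_section.
apply/cvg_closeP; split.
  by apply: is_cvg_nneseries => n _ _; exact: step_ge0.
by rewrite closeE// integral_nneseries.
Qed.

HB.instance Definition _ h := isMeasure.Build _ _ R
  (step_prob h) (step0 h) (step_ge0 h) (@step_sigma_additive h).

Definition step_kernel
  : i.-tuple (bool * TR) -> {measure set (i.+1.-tuple (bool * TR)) -> \bar R}
  := step_prob.

Local Notation H := (i.-tuple (bool * TR)).

Let measurable_action (j : 'I_i) :
  measurable_fun [set: H] (fun h => (tnth h j).1).
Proof.
by apply: measurableT_comp; [exact: measurable_fst|exact: measurable_tnth].
Qed.

Let measurable_income (j : 'I_i) :
  measurable_fun [set: H] (fun h => (tnth h j).2).
Proof.
by apply: measurableT_comp; [exact: measurable_snd|exact: measurable_tnth].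
Qed.

Let measurable_income2 : measurable_fun [set: H] (fun h => income2 h).
Proof.
rewrite (_ : (fun h => _) = (fun h : H =>
    \sum_(j <- index_enum 'I_i)
      (if (tnth h j).1 then (tnth h j).2 else 0)%R)%R).
  apply: measurable_sum => j; apply: measurable_fun_ifT => //.
  exact: measurable_income.
by apply/funext => h; rewrite /income2 big_tuple big_mkcond.
Qed.

Let measurable_count (p : pred bool) k :
  measurable [set h : H | count (fun z => p z.1) h = k].
Proof.
pose f (h : H) : R :=
  (\sum_(j <- index_enum 'I_i) (if p (tnth h j).1 then 1 else 0))%R.
have mf : measurable_fun [set: H] f.
  apply: measurable_sum => j; apply: measurable_fun_ifT => //.
  exact: (measurableT_comp (f := p)).
rewrite (_ : [set h | _] = [set: H] `&` f @^-1` [set k%:R%R]).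
  exact: mf.
have fE h : f h = (count (fun z => p z.1) h)%:R%R.
  by rewrite /f -sum1_count big_tuple natr_sum [RHS]big_mkcond.
rewrite setTI; apply/seteqP; split => h /=; rewrite fE; first by move=> ->.
by move=> /eqP; rewrite eqr_nat => /eqP.
Qed.

Lemma measurable_next_action2 :
  measurable_fun [set: H] (fun h => next_action2 M sigma h).
Proof.
pose g k n (h : H) : R := if (M %| k)%N && (M %| n)%N
  then select2 sigma k (income2 h) n else ((head (false, 0%R) h).1)%:R%R.
have mg k n : measurable_fun [set: H] (g k n).
  rewrite /g; case: ((M %| k)%N && (M %| n)%N); last exact: measurable_last.
  exact: measurableT_comp (measurable_select2 sigma k n) measurable_income2.
move=> _ Y mY; rewrite setTI.
rewrite (_ : _ @^-1` Y = \bigcup_k \bigcup_n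
    ([set h : H | uses1 h = k] `&` [set h : H | uses2 h = n] `&`
     ([set: H] `&` g k n @^-1` Y))).
  apply: bigcupT_measurable => k; apply: bigcupT_measurable => n.
  apply: measurableI; last exact: mg.
  apply: measurableI; [exact: (measurable_count negb)|
                       exact: (measurable_count id)].
apply/seteqP; split => h /=.
  by move=> Yh; exists (uses1 h) => //; exists (uses2 h).
by move=> [k _ [n _ [[<- <-] []]]].
Qed.

Let measurable_step A : measurable A ->
  measurable_fun [set: H] (fun h => step_kernel h A : \bar R).
Proof.
move=> mA.
have next01 h : (0 <= next_action2 M sigma h <= 1)%R.
  rewrite /next_action2; case: ifP => _; first exact: select2_bounds.
  by case: (head _ _).1; rewrite /= ?ler01 ?lexx.
pose F a h := income_prob a [set x | A (extend h (a, x))].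
have mF a : measurable_fun [set: H] (F a).
  pose B := [set z : H * TR | A (extend z.1 (a, z.2))].
  have mB : measurable B.
    by rewrite -[B]setTI; exact: measurable_extend.
  rewrite (_ : F a = income_prob a \o xsection B).
    exact: measurable_fun_xsection.
  by apply/funext => h; rewrite /F /= xsectionE.
rewrite (_ : (fun h => step_kernel h A) = (fun h =>
    (next_action2 M sigma h)%:E * F true h +
    (1 - next_action2 M sigma h)%:E * F false h)).
  apply: emeasurable_funD; apply: emeasurable_funM => //.
    by apply/measurable_EFinP; exact: measurable_next_action2.
  apply/measurable_EFinP; apply: measurable_funB => //.
  exact: measurable_next_action2.
apply/funext => h; rewrite /step_kernel /= /step_prob.
by rewrite integral_bernoulli_prob.
Qed.

HB.instance Definition _ := isKernel.Build _ _ _ _ R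
  step_kernel measurable_step.

Let step_setT h : step_kernel h [set: _] = 1.
Proof.
rewrite /step_kernel /= /step_prob (eq_integral (cst 1)).
  by rewrite integral_cst// mul1e; exact: probability_setT.
by move=> a _; rewrite (_ : [set x | _] = setT) ?probability_setT.
Qed.

HB.instance Definition _ := Kernel_isProbability.Build _ _ _ _ R
  step_kernel step_setT.

End step.

(* Law of (y_j, xi_j), j = i, ..., 1, when sigma is used and the second action
   has expected income m: y_j is drawn given the past, then xi_j given y_j. *)
Fixpoint trajectory_prob i : probability (i.-tuple (bool * TR)) R :=
  if i is j.+1 then
    (probability_bind (trajectory_prob j) (@step_kernel j)
      : probability (j.+1.-tuple (bool * TR)) R)
  else (\d_([tuple] : 0.-tuple (bool * TR))
      : probability (0.-tuple (bool * TR)) R).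

End trajectory_law.

Section bandit.
Context (R : realType) (N M : nat) (D C : R).
Variables (mu1 : probability (measurableTypeR R) R) (lambda : R -> R).
Local Notation mu := lebesgue_measure.
Local Open Scope ereal_scope.

Definition expected_income (sigma : strategy R) (m : R) : \bar R :=
  'E_(trajectory_prob M D mu1 sigma m N)
    [fun h : N.-tuple (bool * measurableTypeR R) => total_income h].

Definition loss (sigma : strategy R) (m : R) : \bar R :=
  (N%:R * Num.max 0 m)%:E - expected_income sigma m.

Definition average_loss (sigma : strategy R) : \bar R :=
  \int[mu]_(m in `[(- C)%R, C]) (loss sigma m * (lambda m)%:E).

(* The Bayesian risk is a minimum over strategies: it is attained. *)
Definition is_bayes_risk (r : \bar R) : Prop :=
  (exists sigma, average_loss sigma = r) /\
  (forall sigma, r <= average_loss sigma).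

Definition g1 (X : R) (n : nat) : \bar R :=
  \int[mu]_(m in `[0%R, C])
    (m * expR (D^-1 * (X * m - 2^-1 * n%:R * m ^+ 2)) * lambda m)%:E.

Definition g2 (X : R) (n : nat) : \bar R :=
  \int[mu]_(m in `[(- C)%R, 0%R])
    (`|m| * expR (D^-1 * (X * m - 2^-1 * n%:R * m ^+ 2)) * lambda m)%:E.

Record dp_equation (Rk R1 R2 : nat -> R -> nat -> \bar R) : Prop :=
  DpEquation {
  dp_min : forall k X n, (M %| k)%N -> (M %| n)%N -> (k + n <= N)%N ->
    Rk k X n = mine (R1 k X n) (R2 k X n) ;
  dp_final : forall k X n, (M %| k)%N -> (M %| n)%N -> (k + n = N)%N ->
    R1 k X n = 0 /\ R2 k X n = 0 ;
  dp_step1 : forall k X n, (M %| k)%N -> (M %| n)%N -> (k + n < N)%N ->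
    R1 k X n = M%:R%:E * g1 X n + Rk (k + M)%N X n ;
  dp_step2 : forall k X n, (M %| k)%N -> (M %| n)%N -> (k + n < N)%N ->
    R2 k X n = M%:R%:E * g2 X n +
      convolution (fun x => Rk k x (n + M)%N)
                  (gauss_pdf (M%:R * D)%R 0%R) X }.

(* lambda is a probability density on [-C, C] charging both signs of m *)
Record admissible_prior : Prop := AdmissiblePrior {
  prior_measurable : measurable_fun `[(- C)%R, C] lambda ;
  prior_ge0 : forall m, (- C <= m <= C)%R -> (0 <= lambda m)%R ;
  prior_total : \int[mu]_(m in `[(- C)%R, C]) (lambda m)%:E = 1 ;
  prior_neg : 0 < \int[mu]_(m in `[(- C)%R, 0%R]) (`|m| * lambda m)%:E ;
  prior_pos : 0 < \int[mu]_(m in `[0%R, C]) (m * lambda m)%:E }.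

End bandit.

(* Main.v *)
From HB Require Import structures.
Require Import Defs.
From mathcomp Require Import all_boot all_order all_algebra.
From mathcomp Require Import all_classical all_reals all_analysis.
From mathcomp Require Import measurable_realfun.
From mathcomp Require Import ring lra zify.
Import Order.TTheory GRing.Theory Num.Theory.
Import numFieldNormedType.Exports.
Import HBNNSimple.
Local Open Scope classical_set_scope.
Local Open Scope ring_scope.
Set Implicit Arguments.
Unset Strict Implicit.
Unset Printing Implicit Defensive.

(** Since the first action has mean income 0, the loss under m equals the
    expectation of max(0, m) k + max(0, -m) n, where k and n are the final
    numbers of uses of the two actions. Changing measure from m to 0 multiplies
    the integrand by the likelihood ratio exp((X m - n m^2 / 2) / D), so by
    Tonelli the average loss is the expectation, under m = 0, of
    k g1(X, n) + n g2(X, n). Under m = 0 both g1 and g2 are martingales along the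
    second action, and M successive incomes of that action add up to a N(0, MD)
    variable; hence one batch turns k g1 + n g2 + R(k, X, n) into
    k g1 + n g2 + R_a(k, X, n), a being the selected action. Backward induction
    on the number of remaining batches gives the lower bound R(0, 0, 0), which is
    attained by selecting the action with the smaller R_a. *)

(** * Gaussian integrals *)

(** Almost everything is computed with nonnegative extended-real functions, so Tonelli applies
    without knowing that [g1], [g2] or the value functions are finite. The one signed quantity that
    matters is the total income; its positive and negative parts are treated separately and
    subtracted once both are known to be finite. Trajectories of different lengths live in different
    tuple types, while a recursion wants a single type. Functionals are therefore taken on lists,
    and an expectation over trajectories becomes an iterate of the transition operator [step_op]
    evaluated at the empty history. Change of measure and batching are then identities about this
    operator. The average loss collects its whole cost at the horizon, whereas the dynamic
    programming equation charges [M * g_a] batch by batch; the martingale property is what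
    reconciles the two accounts. That equation constrains [Rk], [R1], [R2] only on the grid of
    multiples of [M] and assumes no measurability, so regularity has to be recovered backwards
    before a convolution can be read as a Gaussian expectation. *)

Section gaussian.
Context (R : realType).
Local Notation TR := (measurableTypeR R).
Local Notation mu := (@lebesgue_measure R).
Implicit Types (f : R -> \bar R) (m V c : R).
Local Open Scope ereal_scope.

(** Lebesgue measure is determined by its values on half-open intervals, and translation preserves
    their length; the integral identity is then a change of variables through the pushforward. *)
Lemma ge0_integral_shift c f : measurable_fun [set: TR] f ->
  (forall x, 0 <= f x) -> \int[mu]_x f (c + x)%R = \int[mu]_x f x.
Proof.
move=> mf f0; have mc : measurable_fun [set: TR] (+%R c : TR -> TR).
  exact: measurable_funD.
pose shift : {mfun TR >-> TR} :=
  HB.pack (+%R c : TR -> TR) (isMeasurableFun.Build _ _ _ _ _ mc).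
have shiftE (A : set TR) : measurable A -> mu A = pushforward mu shift A.
  move=> mA; apply: lebesgue_measure_unique => //= _ [[a b]] _ <-.
  rewrite /pushforward/=.
  rewrite (_ : _ @^-1` _ = `](a - c)%R, (b - c)%R]%classic).
    rewrite !lebesgue_measure_itv/= !lte_fin ltrD2r.
    by rewrite -!EFinB opprB addrA subrK.
  by apply/seteqP; split => x /=; rewrite !in_itv/= ltrBlDl lerBrDl.
rewrite -[RHS](@eq_measure_integral _ _ _ _ _ (pushforward mu shift)).
  by rewrite ge0_integral_pushforward// preimage_setT.
by move=> A mA _; rewrite [RHS]shiftE.
Qed.

Lemma ge0_integral_opp f : measurable_fun [set: TR] f ->
  (forall x, 0 <= f x) -> \int[mu]_x f (- x)%R = \int[mu]_x f x.
Proof.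
move=> mf f0.
rewrite -[RHS](@eq_measure_integral _ _ _ _ _ (pushforward mu (-%R : TR -> TR))).
  by rewrite ge0_integral_pushforward// preimage_setT.
by move=> A mA _; exact: lebesgue_measureN.
Qed.

End gaussian.

(** The density is given only through measures of sets. Linearity passes this to simple functions
    and monotone convergence to all nonnegative measurable ones. *)
Lemma ge0_integral_density d (T : measurableType d) (R : realType)
    (mu nu : {measure set T -> \bar R}) (p : T -> R) (f : T -> \bar R) :
  measurable_fun [set: T] p -> (forall x, 0 <= p x) ->
  (forall A, measurable A -> nu A = \int[mu]_(x in A) (p x)%:E)%E ->
  measurable_fun [set: T] f -> (forall x, 0 <= f x)%E ->
  (\int[nu]_x f x = \int[mu]_x (f x * (p x)%:E))%E.
Proof.
move=> mp p0 nuE mf f0; have mpE : measurable_fun [set: T] (EFin \o p).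
  exact/measurable_EFinP.
pose g := nnsfun_approx measurableT mf.
have g0 n x : (0 <= (g n x)%:E)%E by rewrite lee_fin.
have mg n : measurable_fun [set: T] (fun x => (g n x)%:E).
  exact/measurable_EFinP.
have ndg x : {homo (fun n => (g n x)%:E) : n m / (n <= m)%O >-> (n <= m)%E}.
  by move=> n m nm; rewrite lee_fin; exact/lefP/nd_nnsfun_approx.
have gE n : (\int[nu]_x (g n x)%:E = \int[mu]_x ((g n x)%:E * (p x)%:E))%E.
  rewrite (integralT_nnsfun nu) sintegralE.
  have hr r x : (0 <= (r * \1_(g n @^-1` [set r]) x)%:E * (p x)%:E)%E.
    by rewrite mule_ge0 ?lee_fin// -lee_fin EFinM nnfun_muleindic_ge0.
  under [RHS]eq_integral => x _.
    rewrite fimfunE -fsumEFin// ge0_mule_fsuml; last first.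
      by move=> r; rewrite EFinM nnfun_muleindic_ge0.
    over.
  rewrite ge0_integral_fsum//; last first.
    move=> r; apply: emeasurable_funM => //.
    by apply/measurable_EFinP; apply: measurable_funM.
  apply: eq_fsbigr => r _.
  (* A negative [r] has an empty level set; for the other values the sign lets the constant leave
     the integral. *)
  have [r0|r0] := ltP r 0.
    rewrite preimage_nnfun0// measure0 mule0 integral0_eq// => x _.
    by rewrite indic0 mulr0 mul0e.
  under eq_integral do rewrite EFinM -muleA.
  rewrite ge0_integralZl//=; first last.
  - by move=> x _; rewrite mule_ge0 ?lee_fin.
  - by apply: emeasurable_funM => //; exact/measurable_EFinP.
  congr (_ * _)%E; rewrite nuE// integral_mkcond; apply: eq_integral => x _.
  by rewrite epatch_indic muleC.
transitivity (\int[nu]_x limn (fun n => (g n x)%:E))%E.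
  by apply: eq_integral => x _; apply/esym/cvg_lim => //; exact: cvg_nnsfun_approx.
rewrite monotone_convergence//; under eq_fun do rewrite gE.
rewrite -monotone_convergence//; first last.
- by move=> x _ n m nm; rewrite lee_wpmul2r ?lee_fin// -lee_fin; exact: ndg.
- by move=> n x _; rewrite mule_ge0 ?lee_fin.
- by move=> n; exact: emeasurable_funM.
apply: eq_integral => x _; apply/cvg_lim => //.
apply: cvgeZr => //; exact: cvg_nnsfun_approx.
Qed.

Section normal.
Context (R : realType).
Local Notation TR := (measurableTypeR R).
Local Notation mu := (@lebesgue_measure R).
Implicit Types (f : R -> \bar R) (m V c x z : R).

Lemma ge0_integral_normal_prob m s f : measurable_fun [set: TR] f ->
  (forall x, 0 <= f x)%E ->
  (\int[normal_prob m s]_x f x = \int[mu]_x (f x * (normal_pdf m s x)%:E))%E.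
Proof.
move=> mf f0; apply: ge0_integral_density => //.
- exact: measurable_normal_pdf.
- exact: normal_pdf_ge0.
Qed.

Lemma gauss_pdfE V m x : 0 < V -> gauss_pdf V m x =
  (Num.sqrt (V * pi *+ 2))^-1 * expR (- (x - m) ^+ 2 / (V *+ 2)).
Proof.
move=> V0; rewrite /gauss_pdf normal_pdfE ?gt_eqF ?sqrtr_gt0//.
by rewrite /normal_peak /normal_fun sqr_sqrtr// ltW.
Qed.

Lemma gauss_pdf_likelihood V m x : 0 < V -> gauss_pdf V m x =
  expR (V^-1 * (x * m - 2^-1 * m ^+ 2)) * gauss_pdf V 0 x.
Proof.
move=> V0; rewrite !gauss_pdfE// mulrCA -expRD; congr (_ * expR _).
by field; rewrite gt_eqF.
Qed.

(** Completing the square in [x]. For independent summands of variances [V] and [W] with total [z],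
    the right side is the density of the total times the conditional density of the first summand,
    so [x] can be integrated out. *)
Lemma gauss_pdfD V W x z : 0 < V -> 0 < W ->
  gauss_pdf V 0 x * gauss_pdf W 0 (z - x) =
  gauss_pdf (V + W) 0 z * gauss_pdf (V * W / (V + W)) (V * z / (V + W)) x.
Proof.
move=> V0 W0; have VW0 : 0 < V + W by rewrite addr_gt0.
rewrite !gauss_pdfE// ?divr_gt0 ?mulr_gt0//.
rewrite mulrACA -expRD [RHS]mulrACA -expRD -!invfM -!sqrtrM; last 2 first.
- by rewrite mulrn_wge0// mulr_ge0 ?pi_ge0// ltW.
- by rewrite mulrn_wge0// mulr_ge0 ?pi_ge0// ltW.
congr ((Num.sqrt _)^-1 * expR _); field; rewrite ?gt_eqF//.
Qed.

End normal.

Lemma integral_probability_cst d (T : measurableType d) (R : realType)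
  (P : probability T R) (r : \bar R) : (\int[P]_x cst r x = r)%E.
Proof.
rewrite integral_cst// -[RHS]mule1; congr *%E; exact: probability_setT.
Qed.

Section normal_integral.
Context (R : realType).
Local Notation TR := (measurableTypeR R).
Local Notation mu := (@lebesgue_measure R).
Local Notation N01 V := (normal_prob 0%R (Num.sqrt V)).
Implicit Types (f : R -> \bar R) (m V c x z : R).
Local Open Scope ereal_scope.

Lemma measurable_gauss_pdf V m : measurable_fun [set: TR] (gauss_pdf V m).
Proof. exact: measurable_normal_pdf. Qed.

Let ge0_mul_normal_pdf m s f :
  measurable_fun [set: TR] f -> (forall x, 0 <= f x) ->
  measurable_fun [set: TR] (fun x => f x * (normal_pdf m s x)%:E) /\
  (forall x, 0 <= f x * (normal_pdf m s x)%:E).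
Proof.
move=> mf f0; split; last first.
  by move=> x; rewrite mule_ge0// lee_fin normal_pdf_ge0.
apply: emeasurable_funM => //; apply/measurable_EFinP.
exact: measurable_normal_pdf.
Qed.

Lemma ge0_integral_normal_likelihood V m f : (0 < V)%R ->
  measurable_fun [set: TR] f -> (forall x, 0 <= f x) ->
  \int[normal_prob m (Num.sqrt V)]_x f x =
  \int[N01 V]_x ((expR (V^-1 * (x * m - 2^-1 * m ^+ 2)))%:E * f x).
Proof.
move=> V0 mf f0; set g := fun x => _ * f x.
have mg : measurable_fun [set: TR] g.
  apply: emeasurable_funM => //; apply/measurable_EFinP.
  apply: measurableT_comp => //; apply: measurable_funM => //.
  by apply: measurable_funB => //; exact: measurable_funM.
have g0 x : 0 <= g x by rewrite mule_ge0// lee_fin expR_ge0.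
apply: (etrans (ge0_integral_normal_prob m (Num.sqrt V) mf f0)).
apply: (etrans _ (esym (ge0_integral_normal_prob 0%R _ mg g0))).
apply: eq_integral => x _; rewrite -!/(gauss_pdf _ _ _) /g.
by rewrite (gauss_pdf_likelihood _ _ V0) EFinM muleCA muleA.
Qed.

Lemma integral_normal_likelihood V m : (0 < V)%R ->
  \int[N01 V]_x (expR (V^-1 * (x * m - 2^-1 * m ^+ 2)))%:E = 1.
Proof.
move=> V0; rewrite -[RHS](integral_probability_cst (normal_prob m (Num.sqrt V))).
have c0 (x : R) : 0 <= cst 1 x :> \bar R by exact: lee01.
apply: (etrans _
  (esym (ge0_integral_normal_likelihood m V0 (measurable_cst _) c0))).
by apply: eq_integral => x _; rewrite mule1.
Qed.

Lemma ge0_integral_normal_shift V m f : (0 < V)%R ->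
  measurable_fun [set: TR] f -> (forall x, 0 <= f x) ->
  \int[normal_prob m (Num.sqrt V)]_x f x = \int[N01 V]_x f (m + x)%R.
Proof.
move=> V0 mf f0; have mg : measurable_fun [set: TR] (fun x => f (m + x)%R).
  by apply: measurableT_comp => //; exact: measurable_funD.
apply: (etrans (ge0_integral_normal_prob m (Num.sqrt V) mf f0)).
apply: (etrans _ (esym (ge0_integral_normal_prob 0%R _ mg (fun x => f0 _)))).
have [mh h0] := ge0_mul_normal_pdf m (Num.sqrt V) mf f0.
rewrite -(ge0_integral_shift m mh h0).
apply: eq_integral => x _; rewrite -!/(gauss_pdf _ _ _) !gauss_pdfE//.
by rewrite subr0 (addrC m) addrK.
Qed.

Lemma ge0_integral_normal_opp V f : (0 < V)%R ->
  measurable_fun [set: TR] f -> (forall x, 0 <= f x) ->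
  \int[N01 V]_x f (- x)%R = \int[N01 V]_x f x.
Proof.
move=> V0 mf f0; have mg : measurable_fun [set: TR] (fun x => f (- x)%R).
  exact: measurableT_comp.
apply: (etrans _ (esym (ge0_integral_normal_prob 0%R (Num.sqrt V) mf f0))).
apply: (etrans (ge0_integral_normal_prob 0%R _ mg (fun x => f0 _))).
have [mh h0] := ge0_mul_normal_pdf 0%R (Num.sqrt V) mf f0.
rewrite -[RHS](ge0_integral_opp mh h0).
apply: eq_integral => x _; rewrite -!/(gauss_pdf _ _ _) !gauss_pdfE//.
by rewrite !subr0 sqrrN.
Qed.

(** The convolution evaluates [f] at [X - y]; the symmetry of the centered Gaussian turns this into
    [X + x], the cumulative income after receiving [x]. *)
Lemma convolution_gauss_pdf V f X : (0 < V)%R ->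
  measurable_fun [set: TR] f -> (forall x, 0 <= f x) ->
  convolution f (gauss_pdf V 0%R) X = \int[N01 V]_x f (X + x)%R.
Proof.
move=> V0 mf f0.
have mB : measurable_fun [set: TR] (fun x => f (X - x)%R).
  by apply: measurableT_comp => //; exact: measurable_funB.
have mD : measurable_fun [set: TR] (fun x => f (X + x)%R).
  by apply: measurableT_comp => //; exact: measurable_funD.
rewrite -(ge0_integral_normal_opp V0 mD (fun x => f0 _)).
by rewrite (ge0_integral_normal_prob _ _ mB (fun x => f0 _)).
Qed.

(** In the variables [x] and [z = x + y], Tonelli puts the [x] integral inside, where [gauss_pdfD]
    leaves a probability density of mass one. *)
Lemma ge0_integral_normalD V W f : (0 < V)%R -> (0 < W)%R ->
  measurable_fun [set: TR] f -> (forall x, 0 <= f x) ->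
  \int[N01 V]_x \int[N01 W]_y f (x + y)%R = \int[N01 (V + W)]_z f z.
Proof.
move=> V0 W0 mf f0; have VW0 : (0 < V + W)%R by rewrite addr_gt0.
have g0 U m x : 0 <= (gauss_pdf U m x)%:E by rewrite lee_fin normal_pdf_ge0.
have mgauss (g : TR * TR -> TR) U : measurable_fun [set: TR * TR] g ->
    measurable_fun [set: TR * TR] (fun w => (gauss_pdf U 0%R (g w))%:E).
  move=> mg; apply/measurable_EFinP/measurableT_comp => //.
  exact: measurable_gauss_pdf.
pose k (z : TR * TR) := f z.2 * (gauss_pdf W 0%R (z.2 - z.1)%R)%:E.
have mk : measurable_fun [set: TR * TR] k.
  apply: emeasurable_funM; first exact: measurableT_comp.
  by apply: mgauss; exact: measurable_funB.
have k0 w : 0 <= k w by rewrite mule_ge0.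
pose h (z : TR * TR) := k z * (gauss_pdf V 0%R z.1)%:E.
have mh : measurable_fun [set: TR * TR] h.
  by apply: emeasurable_funM => //; exact: mgauss.
have h0 w : 0 <= h w by rewrite !mule_ge0.
have mkx x : measurable_fun [set: TR] (fun y => k (x, y)).
  exact: measurableT_comp.
have innerE x : \int[N01 W]_y f (x + y)%R = \int[mu]_y k (x, y).
  have mx : measurable_fun [set: TR] (fun y => f (x + y)%R).
    by apply: measurableT_comp => //; exact: measurable_funD.
  rewrite (ge0_integral_normal_prob _ _ mx (fun y => f0 _)).
  rewrite -[RHS](ge0_integral_shift x (mkx x) (fun y => k0 _)).
  by apply: eq_integral => y _; rewrite /k/= (addrC x y) addrK.
have mK : measurable_fun [set: TR] (fun x => \int[mu]_y k (x, y)).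
  exact: (measurable_fun_fubini_tonelli_F (m2 := mu) _ mk).
have K0 x : 0 <= \int[mu]_y k (x, y) by exact: integral_ge0.
transitivity (\int[N01 V]_x \int[mu]_y k (x, y)).
  by apply: eq_integral => x _; exact: innerE.
apply: (etrans (ge0_integral_normal_prob 0%R (Num.sqrt V) mK K0)).
transitivity (\int[mu]_x \int[mu]_y h (x, y)).
  apply: eq_integral => x _; rewrite -ge0_integralZr//.
  exact: g0.
apply: (etrans (fubini_tonelli h mh h0)).
apply: (etrans _ (esym (ge0_integral_normal_prob 0%R _ mf f0))).
apply: eq_integral => y _; rewrite /h/=.
transitivity (\int[mu]_x (f y * (gauss_pdf (V + W) 0%R y)%:E *
    (gauss_pdf (V * W / (V + W)) (V * y / (V + W)) x)%:E)).
  apply: eq_integral => x _; rewrite -!muleA; congr *%E.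
  by rewrite -!EFinM mulrC gauss_pdfD.
rewrite ge0_integralZl//; first by rewrite integral_normal_pdf mule1.
- apply/measurable_EFinP; exact: measurable_gauss_pdf.
- by rewrite mule_ge0.
Qed.

Lemma integrable_normal_id0 V : (0 < V)%R ->
  (N01 V).-integrable [set: TR] (fun x => x%:E).
Proof.
move=> V0; apply/integrableP; split; first exact/measurable_EFinP.
pose e m x : R := expR (V^-1 * (x * m - 2^-1 * m ^+ 2)).
have me m : measurable_fun [set: TR] (fun x => (e m x)%:E).
  apply/measurable_EFinP/measurableT_comp => //; apply: measurable_funM => //.
  by apply: measurable_funB => //; exact: measurable_funM.
have e0 m x : 0 <= (e m x)%:E by rewrite lee_fin expR_ge0.
(* The bound is [|x| <= expR x + expR (- x)]. Each exponential is [expR (V / 2)] times a likelihood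
   ratio, with mean [V] or [- V], and such ratios integrate to 1. *)
apply: (@le_lt_trans _ _ (\int[N01 V]_x
    ((expR (2^-1 * V))%:E * ((e V x)%:E + (e (- V)%R x)%:E)))).
  apply: ge0_le_integral => //.
  - exact: measurableT_comp.
  - by apply: emeasurable_funM => //; exact: emeasurable_funD.
  move=> x _; rewrite /e -EFinD -EFinM/= lee_fin mulrDr -!expRD.
  rewrite (_ : _ + _ = x)%R; last by field; rewrite gt_eqF.
  rewrite [X in (_ <= _ + expR X)%R](_ : _ = - x)%R; last first.
    by field; rewrite gt_eqF.
  have := expR_ge1Dx x; have := expR_ge1Dx (- x)%R.
  have := expR_gt0 x; have := expR_gt0 (- x)%R.
  by case: (ger0P x) => _; lra.
rewrite ge0_integralZl//.
- by rewrite ge0_integralD// !integral_normal_likelihood// -EFinD -EFinM ltry.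
- exact: emeasurable_funD.
- by move=> x _; rewrite adde_ge0.
Qed.

(** Reflection exchanges the positive and negative parts, whose common integral is finite and may be
    cancelled. *)
Lemma integral_normal_id0 V : (0 < V)%R -> \int[N01 V]_x x%:E = 0.
Proof.
move=> V0; have iV := integrable_normal_id0 V0.
have mV : measurable_fun [set: TR] (fun x : TR => x%:E).
  exact/measurable_EFinP.
rewrite integralE -(ge0_integral_normal_opp V0)//; last first.
  exact: measurable_funepos.
rewrite [X in X - _](_ : _ = \int[N01 V]_x (EFin : TR -> \bar R)^\- x); last first.
  by apply: eq_integral => x _; rewrite funeposE funenegE EFinN.
by rewrite subee// integrable_neg_fin_num.
Qed.

Lemma integrable_normal_id V m : (0 < V)%R ->
  (normal_prob m (Num.sqrt V)).-integrable [set: TR] (fun x => x%:E).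
Proof.
move=> V0; apply/integrableP; split; first exact/measurable_EFinP.
rewrite ge0_integral_normal_shift//; last exact: measurableT_comp.
have : (N01 V).-integrable [set: TR] (fun x => (m + x)%:E).
  under eq_fun do rewrite EFinD.
  apply: integrableD => //; last exact: integrable_normal_id0.
  exact: finite_measure_integrable_cst.
by case/integrableP.
Qed.

Lemma integral_normal_id V m : (0 < V)%R ->
  \int[normal_prob m (Num.sqrt V)]_x x%:E = m%:E.
Proof.
move=> V0; have mV : measurable_fun [set: TR] (fun x : TR => x%:E).
  exact/measurable_EFinP.
(* The shift formula covers nonnegative functions only, hence one application to each part. *)
have sp := ge0_integral_normal_shift m V0 (measurable_funepos mV)
  (fun x => funepos_ge0 _ x).
have sn := ge0_integral_normal_shift m V0 (measurable_funeneg mV)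
  (fun x => funeneg_ge0 _ x).
transitivity (\int[N01 V]_x (m + x)%:E).
  rewrite [LHS]integralE sp sn; apply: (etrans _ (esym (integralE _ _ _))).
  by congr (_ - _); apply: eq_integral => x _; rewrite ?funeposE ?funenegE.
under eq_integral do rewrite EFinD.
have im : (N01 V).-integrable [set: TR] (cst m%:E : TR -> \bar R).
  exact: finite_measure_integrable_cst.
apply: (etrans (integralD measurableT im (integrable_normal_id0 V0))).
by rewrite (integral_normal_id0 V0) integral_probability_cst adde0.
Qed.

End normal_integral.

(** * Expectations over trajectories *)

(** The mixture [nu] is characterized by its values on sets rather than fixed to be
    [probability_bind], so that the lemma serves both for appending a step to a trajectory and for
    mixing over the random action within a step. *)
Lemma ge0_integral_bind d1 d2 (T1 : measurableType d1) (T2 : measurableType d2)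
    (R : realType) (P : {measure set T1 -> \bar R})
    (nu : {measure set T2 -> \bar R}) (k : T1 -> {measure set T2 -> \bar R})
    (f : T2 -> \bar R) :
  (forall A, measurable A -> measurable_fun [set: T1] (k ^~ A)) ->
  (forall A, measurable A -> nu A = \int[P]_x k x A)%E ->
  measurable_fun [set: T2] f -> (forall y, 0 <= f y)%E ->
  (\int[nu]_y f y = \int[P]_x \int[k x]_y f y)%E.
Proof.
move=> mk nuE mf f0.
pose g := nnsfun_approx measurableT mf.
have g0 n x : (0 <= (g n x)%:E)%E by rewrite lee_fin.
have mg n : measurable_fun [set: T2] (fun x => (g n x)%:E).
  exact/measurable_EFinP.
have ndg x : {homo (fun n => (g n x)%:E) : n m / (n <= m)%O >-> (n <= m)%E}.
  by move=> n m nm; rewrite lee_fin; exact/lefP/nd_nnsfun_approx.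
have gE n : (\int[nu]_y (g n y)%:E = \int[P]_x \int[k x]_y (g n y)%:E)%E.
  rewrite (integralT_nnsfun nu) sintegralE.
  under [RHS]eq_integral => x _ do rewrite (integralT_nnsfun (k x)) sintegralE.
  rewrite ge0_integral_fsum//; first last.
  - by move=> r x _; exact: nnsfun_mulemu_ge0.
  - by move=> r; apply: measurable_funeM; exact: mk.
  apply: eq_fsbigr => r _.
  have [r0|r0] := ltP r 0.
    rewrite preimage_nnfun0// measure0 mule0 integral0_eq// => x _.
    by rewrite measure0 mule0.
  by rewrite nuE// -ge0_integralZl//; exact: mk.
transitivity (\int[nu]_y limn (fun n => (g n y)%:E))%E.
  by apply: eq_integral => y _; apply/esym/cvg_lim => //; exact: cvg_nnsfun_approx.
rewrite monotone_convergence//; under eq_fun do rewrite gE.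
rewrite -monotone_convergence//; first last.
- by move=> x _ n m nm; apply: ge0_le_integral => // y _; exact: ndg.
- by move=> n x _; exact: integral_ge0.
- by move=> n; exact: measurable_fun_integral_kernel.
apply: eq_integral => x _; rewrite -monotone_convergence//.
by apply: eq_integral => y _; apply/cvg_lim => //; exact: cvg_nnsfun_approx.
Qed.

Section trajectory.
Context (R : realType).
Local Notation TR := (measurableTypeR R).
Local Notation history := (seq (bool * R)).
Implicit Types (f : history -> \bar R) (h : history).

(** Only tuples of a fixed length carry a sigma-algebra here, so measurability of a function on
    lists is required length by length. *)
Definition measurable_traj d (T : measurableType d) (f : history -> T) :=
  forall i, measurable_fun [set: i.-tuple (bool * TR)]
    (fun h : i.-tuple (bool * TR) => f h).

Lemma measurable_traj_sum (w : bool * TR -> R) :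
  measurable_fun [set: bool * TR] w ->
  measurable_traj (fun h => \sum_(z <- h) w z : TR).
Proof.
move=> mw i; rewrite (_ : (fun _ : i.-tuple _ => _) = (fun h : i.-tuple (bool * TR) =>
    \sum_(j <- index_enum 'I_i) w (tnth h j))).
  by apply: measurable_sum => j; apply: measurableT_comp => //;
     exact: measurable_tnth.
by apply/funext => h; rewrite big_tuple.
Qed.

Lemma uses2_sum h : (uses2 h)%:R = \sum_(z <- h) (z.1)%:R :> R.
Proof. by rewrite /uses2 -sum1_count natr_sum big_mkcond; apply: eq_bigr => -[[]]. Qed.

Lemma uses1_sum h : (uses1 h)%:R = \sum_(z <- h) (~~ z.1)%:R :> R.
Proof. by rewrite /uses1 -sum1_count natr_sum big_mkcond; apply: eq_bigr => -[[]]. Qed.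

Lemma uses_size h : (uses1 h + uses2 h = size h)%N.
Proof. by rewrite addnC; exact: (count_predC (fun z => z.1)). Qed.

Lemma measurable_bool_fun (b : bool -> R) :
  measurable_fun [set: bool * TR] (fun z => b z.1).
Proof. exact: (measurableT_comp (f := b)). Qed.

Lemma measurable_uses2 : measurable_traj (fun h => (uses2 h)%:R : TR).
Proof.
rewrite (_ : (fun h => _) = (fun h => \sum_(z <- h) (z.1)%:R : TR)).
  apply: measurable_traj_sum; exact: (measurable_bool_fun (fun b => b%:R)).
by apply/funext => h; rewrite uses2_sum.
Qed.

Lemma measurable_uses1 : measurable_traj (fun h => (uses1 h)%:R : TR).
Proof.
rewrite (_ : (fun h => _) = (fun h => \sum_(z <- h) (~~ z.1)%:R : TR)).
  apply: measurable_traj_sum; exact: (measurable_bool_fun (fun b => (~~ b)%:R)).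
by apply/funext => h; rewrite uses1_sum.
Qed.

Lemma measurable_income2 : measurable_traj (fun h => income2 h : TR).
Proof.
rewrite (_ : (fun h => _) = (fun h => \sum_(z <- h) (if z.1 then z.2 else 0) : TR)).
  apply: measurable_traj_sum; exact: measurable_fun_ifT.
by apply/funext => h; rewrite /income2 big_mkcond.
Qed.

Section law.
Variables (M : nat) (D : R) (mu1 : probability TR R) (sigma : strategy R) (m : R).
Local Open Scope ereal_scope.

Local Notation income := (income_prob D mu1 m).
Local Notation p := (next_action2 M sigma).

Lemma next_action2_bounds h : (0 <= p h <= 1)%R.
Proof.
rewrite /next_action2; case: ifP => _; first exact: select2_bounds.
by case: (head _ _).1; rewrite /= ?ler01 ?lexx.
Qed.

Lemma next_action2_ge0 h : 0 <= (p h)%:E.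
Proof. by rewrite lee_fin; case/andP: (next_action2_bounds h). Qed.

Lemma next_action1_ge0 h : 0 <= (1 - p h)%:E.
Proof. by rewrite lee_fin subr_ge0; case/andP: (next_action2_bounds h). Qed.

(** Transition operator of the history process: the conditional expectation of [f] after one more
    step, given the history [h]. It maps list functions to list functions and can therefore be
    iterated. *)
Definition step_op f h : \bar R :=
  (p h)%:E * \int[income true]_x f ((true, x) :: h) +
  (1 - p h)%:E * \int[income false]_x f ((false, x) :: h).

Lemma step_op_ge0 f h : (forall h, 0 <= f h) -> 0 <= step_op f h.
Proof.
move=> f0; rewrite adde_ge0// mule_ge0 ?next_action2_ge0 ?next_action1_ge0//;
exact: integral_ge0.
Qed.

Lemma measurable_traj_cons f a i : measurable_traj f ->
  measurable_fun [set: i.-tuple (bool * TR) * TR] (fun z => f ((a, z.2) :: z.1)).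
Proof.
move=> mf; have me := @measurable_extend R i a.
exact: (measurableT_comp (mf i.+1) me).
Qed.

Lemma measurable_traj_income f (a : bool) : measurable_traj f ->
  (forall h, 0 <= f h) ->
  measurable_traj (fun h => \int[income a]_x f ((a, x) :: h)).
Proof.
move=> mf f0 i; apply: (measurable_fun_fubini_tonelli_F (m2 := income a) _
  (measurable_traj_cons a (i := i) mf)).
by move=> z; exact: f0.
Qed.

Lemma measurable_traj_next2 : measurable_traj (fun h => (p h)%:E).
Proof. by move=> i; apply/measurable_EFinP; exact: measurable_next_action2. Qed.

Lemma measurable_traj_next1 : measurable_traj (fun h => (1 - p h)%:E).
Proof.
move=> i; apply/measurable_EFinP/measurable_funB => //.
exact: measurable_next_action2.
Qed.

Lemma measurable_step_op f : measurable_traj f -> (forall h, 0 <= f h) ->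
  measurable_traj (step_op f).
Proof.
move=> mf f0 i; apply: emeasurable_funD; apply: emeasurable_funM.
- exact: measurable_traj_next2.
- exact: measurable_traj_income.
- exact: measurable_traj_next1.
- exact: measurable_traj_income.
Qed.

Lemma integral_step_prob i (h : i.-tuple (bool * TR)) f : measurable_traj f ->
  (forall h, 0 <= f h) ->
  \int[step_prob M D mu1 sigma m h]_z f z = step_op f h.
Proof.
move=> mf f0.
have mext a : measurable_fun [set: TR] (fun x => extend h (a, x)).
  apply: measurable_cons => //; exact: measurable_fun_pair.
pose phi a : {mfun TR >-> i.+1.-tuple (bool * TR)} :=
  HB.pack (fun x => extend h (a, x)) (isMeasurableFun.Build _ _ _ _ _ (mext a)).
(* Given the action, the new history is the image of the income under [extend], so [step_prob] is a
   Bernoulli mixture of two pushforwards. *)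
rewrite (ge0_integral_bind (P := bernoulli_prob (p h))
  (k := fun a => pushforward (income a) (phi a)))//.
  rewrite integral_bernoulli_prob ?next_action2_bounds//.
    rewrite !ge0_integral_pushforward//; try exact: mf.
  by move=> a; exact: integral_ge0.
exact: mf.
Qed.

Lemma integral_trajectoryS i f : measurable_traj f -> (forall h, 0 <= f h) ->
  \int[trajectory_prob M D mu1 sigma m i.+1]_h f h =
  \int[trajectory_prob M D mu1 sigma m i]_h step_op f h.
Proof.
move=> mf f0.
rewrite (ge0_integral_bind (P := trajectory_prob M D mu1 sigma m i)
  (k := fun h : i.-tuple (bool * TR) => @step_kernel R M D mu1 sigma m i h))//.
- by apply: eq_integral => h _; rewrite integral_step_prob.
- by move=> A mA; exact: measurable_kernel.
- exact: mf.
Qed.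

(** The latest step is integrated out first; after [i] steps only the point mass at the empty
    history remains. *)
Lemma integral_trajectory i f : measurable_traj f -> (forall h, 0 <= f h) ->
  \int[trajectory_prob M D mu1 sigma m i]_h f h = iter i step_op f [::].
Proof.
elim: i f => [|i ih] f mf f0.
  by rewrite /= integral_dirac ?diracT ?mul1e//; exact: mf.
rewrite integral_trajectoryS// ih -?iterSr//; first exact: measurable_step_op.
by move=> h; exact: step_op_ge0.
Qed.

End law.
End trajectory.

(** * Change of measure, and Wald identities for the incomes *)

Section loss.
Context (R : realType).
Local Notation TR := (measurableTypeR R).
Local Notation history := (seq (bool * R)).
Variables (M : nat) (D : R) (mu1 : probability TR R) (sigma : strategy R).
Hypothesis D0 : 0 < D.
Implicit Types (f : history -> \bar R) (h : history) (m : R).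
Local Open Scope ereal_scope.
Local Notation p := (next_action2 M sigma).
Local Notation traj m i := (trajectory_prob M D mu1 sigma m i).

(** Density on trajectories of the law with mean [m] relative to the law with mean 0. Selection
    probabilities and incomes of the first action do not depend on [m] and cancel in the ratio. *)
Definition likelihood m h : R :=
  expR (D^-1 * (income2 h * m - 2^-1 * (uses2 h)%:R * m ^+ 2)).

Lemma likelihood_ge0 m h : 0 <= (likelihood m h)%:E.
Proof. by rewrite lee_fin expR_ge0. Qed.

Lemma measurable_likelihood m : measurable_traj (fun h => (likelihood m h)%:E).
Proof.
move=> i; apply/measurable_EFinP/measurableT_comp => //.
apply: measurable_funM => //; apply: measurable_funB.
  by apply: measurable_funM => //; exact: measurable_income2.
apply: measurable_funM => //; apply: measurable_funM => //.
exact: measurable_uses2.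
Qed.

Lemma income2_cons a (x : R) h :
  income2 ((a, x) :: h) = (if a then x + income2 h else income2 h)%R.
Proof. by rewrite /income2 big_cons; case: a. Qed.

Lemma likelihood_true m x h : likelihood m ((true, x) :: h) =
  (likelihood m h * expR (D^-1 * (x * m - 2^-1 * m ^+ 2)))%R.
Proof.
rewrite /likelihood income2_cons /uses2/= -/(uses2 h) natrD -expRD.
by congr expR; ring.
Qed.

Lemma likelihood_false m x h : likelihood m ((false, x) :: h) = likelihood m h.
Proof. by rewrite /likelihood income2_cons. Qed.

Lemma measurable_traj_consx f a h : measurable_traj f ->
  measurable_fun [set: TR] (fun x : TR => f ((a, x) :: h)).
Proof.
move=> mf; have mx : measurable_fun [set: TR]
    (fun x : TR => extend (in_tuple h : (size h).-tuple (bool * TR)) (a, x)).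
  by apply: measurable_cons => //; exact: measurable_fun_pair.
exact: (measurableT_comp (mf (size h).+1) mx).
Qed.

(** The likelihood is multiplicative: a use of the second action contributes the one-step Gaussian
    ratio, a use of the first contributes 1. Hence weighting by it intertwines the transition
    operators for [m] and for 0. *)
Lemma step_op_likelihood m f h : measurable_traj f -> (forall h, 0 <= f h) ->
  (likelihood m h)%:E * step_op M D mu1 sigma m f h =
  step_op M D mu1 sigma 0%R (fun h => (likelihood m h)%:E * f h) h.
Proof.
move=> mf f0; have L0 := likelihood_ge0 m h.
have mf1 a := measurable_traj_consx a h mf.
rewrite /step_op ge0_muleDr; last 2 first.
- by rewrite mule_ge0 ?next_action2_ge0 ?integral_ge0.
- by rewrite mule_ge0 ?next_action1_ge0 ?integral_ge0.
congr (_ + _); rewrite muleCA; congr *%E; rewrite /income_prob.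
- rewrite (ge0_integral_normal_likelihood m D0 (mf1 true) (fun x => f0 _)).
  rewrite -ge0_integralZl//.
  + by apply: eq_integral => x _; rewrite likelihood_true EFinM muleA.
  + apply: emeasurable_funM; last exact: mf1.
    apply/measurable_EFinP/measurableT_comp => //; apply: measurable_funM => //.
    by apply: measurable_funB => //; exact: measurable_funM.
  + by move=> x _; rewrite mule_ge0// lee_fin expR_ge0.
- apply: (etrans (esym
    (ge0_integralZl mu1 measurableT (mf1 false) (fun x _ => f0 _) L0))).
  by apply: eq_integral => x _; rewrite likelihood_false.
Qed.

Lemma integral_trajectory_likelihood m i f : measurable_traj f ->
  (forall h, 0 <= f h) ->
  \int[traj m i]_h f h = \int[traj 0%R i]_h ((likelihood m h)%:E * f h).
Proof.
elim: i f => [|i ih] f mf f0; have mL := measurable_likelihood m.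
  rewrite /= !integral_dirac//; first last.
  - exact: (mf 0%N).
  - exact: (emeasurable_funM (mL 0%N) (mf 0%N)).
  by rewrite /likelihood /income2 big_nil mul0r mulr0 mul0r subr0 mulr0 expR0 mul1e.
have mLf : measurable_traj (fun h => (likelihood m h)%:E * f h).
  by move=> j; apply: emeasurable_funM; [exact: mL|exact: mf].
have Lf0 h : 0 <= (likelihood m h)%:E * f h.
  by rewrite mule_ge0// likelihood_ge0.
apply: (etrans (integral_trajectoryS M D mu1 sigma m i mf f0)).
apply: (etrans _ (esym (integral_trajectoryS M D mu1 sigma 0%R i mLf Lf0))).
apply: (etrans (ih _ (measurable_step_op _ _ _ _ _ mf f0)
  (fun h => step_op_ge0 _ _ _ _ _ _ f0))).
by apply: eq_integral => h _; exact: step_op_likelihood.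
Qed.

Section counts.
Variable m : R.
Local Notation income := (income_prob D mu1 m).

Lemma integral_trajectory_sumS i (w : bool -> R -> R) :
  (forall a, measurable_fun [set: TR] (w a)) -> (forall a x, 0 <= w a x)%R ->
  \int[traj m i.+1]_h (\sum_(z <- h) w z.1 z.2)%:E =
  \int[traj m i]_h (\sum_(z <- h) w z.1 z.2)%:E +
  ((\int[traj m i]_h (p h)%:E) * (\int[income true]_x (w true x)%:E) +
   (\int[traj m i]_h (1 - p h)%:E) * (\int[income false]_x (w false x)%:E)).
Proof.
move=> mw w0.
pose f h := (\sum_(z <- h) w z.1 z.2)%:E.
have f0 h : 0 <= f h by rewrite lee_fin sumr_ge0.
have mf : measurable_traj f.
  move=> j; apply/measurable_EFinP.
  apply: (@measurable_traj_sum R (fun z => w z.1 z.2)).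
  rewrite (_ : (fun _ => _) = (fun z : bool * TR =>
    if z.1 then w true z.2 else w false z.2)); last by apply/funext => -[[]].
  by apply: measurable_fun_ifT => //; exact: measurableT_comp.
rewrite (integral_trajectoryS M D mu1 sigma m i mf f0).
have wa0 a x : 0 <= (w a x)%:E by rewrite lee_fin.
have mwa a : measurable_fun [set: TR] (fun x : TR => (w a x)%:E).
  exact/measurable_EFinP.
have c0 a : 0 <= \int[income a]_x (w a x)%:E by exact: integral_ge0.
have fE a h : \int[income a]_x f ((a, x) :: h) =
    (\int[income a]_x (w a x)%:E) + f h.
  transitivity (\int[income a]_x ((w a x)%:E + cst (f h) x)).
    by apply: eq_integral => x _; rewrite /f big_cons.
  rewrite ge0_integralD//; first by congr (_ + _); exact: integral_probability_cst.
  by move=> x _; exact: f0.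
transitivity (\int[traj m i]_h (f h +
   ((p h)%:E * (\int[income true]_x (w true x)%:E) +
    (1 - p h)%:E * (\int[income false]_x (w false x)%:E)))).
  apply: eq_integral => h _; rewrite /step_op !fE.
  (* The two copies of [f h] carry the weights [p h] and [1 - p h], which add up to 1. *)
  rewrite !(ge0_muleDr _ (c0 _) (f0 _)) addeACA addeC; congr (_ + _).
  rewrite -ge0_muleDl ?next_action2_ge0 ?next_action1_ge0//.
  by rewrite -EFinD subrKC mul1e.
have p0 h := next_action2_ge0 M sigma h; have q0 h := next_action1_ge0 M sigma h.
have mp := @measurable_traj_next2 R M sigma i.
have mq := @measurable_traj_next1 R M sigma i.
rewrite ge0_integralD//; first last.
- by apply: emeasurable_funD; exact: emeasurable_funM.
- by move=> h _; rewrite adde_ge0// mule_ge0.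
- exact: mf.
congr (_ + _); rewrite ge0_integralD//; first last.
- exact: emeasurable_funM.
- by move=> h _; rewrite mule_ge0.
- exact: emeasurable_funM.
- by move=> h _; rewrite mule_ge0.
by rewrite !ge0_integralZr.
Qed.

Lemma integral_trajectory_uses2S i :
  \int[traj m i.+1]_h (uses2 h)%:R%:E =
  \int[traj m i]_h (uses2 h)%:R%:E + \int[traj m i]_h (p h)%:E.
Proof.
have := @integral_trajectory_sumS i (fun a _ => a%:R)
  (fun a => measurable_cst _) (fun a _ => ler0n _ _).
rewrite integral_probability_cst (integral0 (income false)) mule1 mule0 adde0.
have E j : \int[traj m j]_h (\sum_(z <- h) (z.1)%:R)%:E =
    \int[traj m j]_h (uses2 h)%:R%:E.
  by apply: eq_integral => h _; rewrite uses2_sum.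
by rewrite !E.
Qed.

Lemma integral_trajectory_uses1S i :
  \int[traj m i.+1]_h (uses1 h)%:R%:E =
  \int[traj m i]_h (uses1 h)%:R%:E + \int[traj m i]_h (1 - p h)%:E.
Proof.
have := @integral_trajectory_sumS i (fun a _ => (~~ a)%:R)
  (fun a => measurable_cst _) (fun a _ => ler0n _ _).
rewrite (integral0 (income true)) integral_probability_cst mule1 mule0 add0e.
have E j : \int[traj m j]_h (\sum_(z <- h) (~~ z.1)%:R)%:E =
    \int[traj m j]_h (uses1 h)%:R%:E.
  by apply: eq_integral => h _; rewrite uses1_sum.
by rewrite !E.
Qed.

(** Wald's identity: each action is chosen from the past alone, so every use of it contributes the
    same mean of [w], however adaptive the strategy. *)
Lemma integral_trajectory_income i (w : R -> R) :
  measurable_fun [set: TR] w -> (forall x, 0 <= w x)%R ->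
  \int[traj m i]_h (\sum_(z <- h) w z.2)%:E =
  (\int[traj m i]_h (uses2 h)%:R%:E) * (\int[income true]_x (w x)%:E) +
  (\int[traj m i]_h (uses1 h)%:R%:E) * (\int[income false]_x (w x)%:E).
Proof.
move=> mw w0; elim: i => [|i ih].
  have z0 (f : history -> \bar R) : f [::] = 0 -> \int[traj m 0%N]_h f h = 0.
    by move=> f0; apply: integral0_eq => h _; rewrite (tuple0 h).
  rewrite (z0 (fun h => (\sum_(z <- h) w z.2)%:E)) ?big_nil//.
  rewrite (z0 (fun h => (uses2 h)%:R%:E))// (z0 (fun h => (uses1 h)%:R%:E))//.
  by rewrite !mul0e adde0.
rewrite (integral_trajectory_sumS _ (w := fun=> w))// ih.
rewrite integral_trajectory_uses1S integral_trajectory_uses2S.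
have n2 : 0 <= \int[traj m i]_h (uses2 h)%:R%:E.
  by apply: integral_ge0 => h _; rewrite lee_fin.
have n1 : 0 <= \int[traj m i]_h (uses1 h)%:R%:E.
  by apply: integral_ge0 => h _; rewrite lee_fin.
have n2p : 0 <= \int[traj m i]_h (p h)%:E.
  by apply: integral_ge0 => h _; exact: next_action2_ge0.
have n1p : 0 <= \int[traj m i]_h (1 - p h)%:E.
  by apply: integral_ge0 => h _; exact: next_action1_ge0.
by rewrite (ge0_muleDl _ n2 n2p) (ge0_muleDl _ n1 n1p) addeACA.
Qed.

End counts.
End loss.

(** * The average loss *)

Lemma ge0_fin_integrable d (T : measurableType d) (R : realType)
    (P : {measure set T -> \bar R}) (f : T -> \bar R) (r : R) :
  measurable_fun [set: T] f -> (forall x, 0 <= f x)%E ->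
  (\int[P]_x f x = r%:E)%E -> P.-integrable [set: T] f.
Proof.
move=> mf f0 fr; apply/integrableP; split=> //.
by under eq_integral do rewrite gee0_abs//; rewrite fr ltry.
Qed.

(** Yields both parts as real numbers, so that Wald's identity can be applied to each and the
    results subtracted in the field [R]. *)
Lemma integral_pos_neg_part (R : realType)
    (P : probability (measurableTypeR R) R) :
  P.-integrable setT (fun x => x%:E) ->
  exists a b : R, [/\ \int[P]_x (Num.max x 0)%:E = a%:E,
    \int[P]_x (Num.max (- x) 0)%:E = b%:E & \int[P]_x x%:E = (a - b)%:E]%E.
Proof.
move=> iP.
have pE : (\int[P]_x (Num.max x 0)%:E = \int[P]_x ((fun x => x%:E)^\+ x))%E.
  by apply: eq_integral => x _; rewrite funeposE -EFin_max.
have nE : (\int[P]_x (Num.max (- x) 0)%:E = \int[P]_x ((fun x => x%:E)^\- x))%E.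
  by apply: eq_integral => x _; rewrite funenegE -EFinN -EFin_max.
exists (fine (\int[P]_x ((fun x => x%:E)^\+ x))%E).
exists (fine (\int[P]_x ((fun x => x%:E)^\- x))%E).
have pf := integrable_pos_fin_num measurableT iP.
have nf := integrable_neg_fin_num measurableT iP.
split; [by rewrite pE fineK|by rewrite nE fineK|].
by rewrite EFinB !fineK//; exact: integralE.
Qed.

Section loss_formula.
Context (R : realType).
Local Notation TR := (measurableTypeR R).
Local Notation history := (seq (bool * R)).
Variables (N M : nat) (D : R) (mu1 : probability TR R) (sigma : strategy R).
Hypothesis D0 : 0 < D.
Hypothesis mu1_integrable : mu1.-integrable setT (fun x => x%:E).
Hypothesis mu1_mean0 : ('E_mu1[fun x => x] = 0)%E.
Local Open Scope ereal_scope.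

(** Let [u1], [u2] be the expected numbers of uses. The expected income is [m * u2] and
    [N = u1 + u2], so the loss is [max 0 m * u1 + (max 0 m - m) * u2], and
    [max 0 m - m = max 0 (- m)]. *)
Lemma loss_trajectory (m : R) : loss N M D mu1 sigma m =
  \int[trajectory_prob M D mu1 sigma m N]_h
    (Num.max 0 m * (uses1 h)%:R + Num.max 0 (- m) * (uses2 h)%:R)%:E.
Proof.
pose P := trajectory_prob M D mu1 sigma m N.
have mN (f : history -> R) : measurable_traj (f : history -> TR) ->
    measurable_fun [set: N.-tuple (bool * TR)] (fun h : N.-tuple _ => (f h)%:E).
  by move=> mf; apply/measurable_EFinP; exact: (mf N).
have m1 := mN _ (@measurable_uses1 R); have m2 := mN _ (@measurable_uses2 R).
have u1_0 (h : N.-tuple (bool * TR)) : 0 <= (uses1 h)%:R%:E :> \bar R.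
  by rewrite lee_fin.
have u2_0 (h : N.-tuple (bool * TR)) : 0 <= (uses2 h)%:R%:E :> \bar R.
  by rewrite lee_fin.
have sumU : \int[P]_h (uses1 h)%:R%:E + \int[P]_h (uses2 h)%:R%:E = N%:R%:E.
  rewrite -ge0_integralD// -[RHS](integral_probability_cst P).
  apply: eq_integral => h _; rewrite -EFinD -natrD uses_size.
  by rewrite size_tuple.
have U1_0 : 0 <= \int[P]_h (uses1 h)%:R%:E by exact: integral_ge0.
have U2_0 : 0 <= \int[P]_h (uses2 h)%:R%:E by exact: integral_ge0.
(* Both expected counts are finite because they are nonnegative with sum [N]. *)
have [u1 U1E] : exists u, \int[P]_h (uses1 h)%:R%:E = u%:E.
  exists (fine (\int[P]_h (uses1 h)%:R%:E)); rewrite fineK// ge0_fin_numE//.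
  by rewrite (@le_lt_trans _ _ N%:R%:E) ?ltry// -sumU leeDl.
have [u2 U2E] : exists u, \int[P]_h (uses2 h)%:R%:E = u%:E.
  exists (fine (\int[P]_h (uses2 h)%:R%:E)); rewrite fineK// ge0_fin_numE//.
  by rewrite (@le_lt_trans _ _ N%:R%:E) ?ltry// -sumU leeDr.
have {}sumU : (u1 + u2 = N%:R)%R.
  by move: sumU; rewrite U1E U2E -EFinD => -[].
have [a1 [b1 [a1E b1E]]] := integral_pos_neg_part (integrable_normal_id m D0).
rewrite integral_normal_id// => -[mE].
have [a0 [b0 [a0E b0E]]] := integral_pos_neg_part mu1_integrable.
move: mu1_mean0; rewrite unlock => -> -[zE].
have sumE (w : R -> R) a b : measurable_fun [set: TR] w ->
    (forall x, 0 <= w x)%R ->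
    \int[income_prob D mu1 m true]_x (w x)%:E = a%:E ->
    \int[income_prob D mu1 m false]_x (w x)%:E = b%:E ->
    P.-integrable setT (fun h : N.-tuple _ => (\sum_(z <- h) w z.2)%:E) /\
    \int[P]_h (\sum_(z <- h) w z.2)%:E = (u2 * a + u1 * b)%:E.
  move=> mw w0 aE bE.
  have SE : \int[P]_h (\sum_(z <- h) w z.2)%:E = (u2 * a + u1 * b)%:E.
    by rewrite integral_trajectory_income// aE bE -/P U1E U2E.
  split => //; apply: ge0_fin_integrable SE => //.
    apply: (mN (fun h => \sum_(z <- h) w z.2)%R).
    apply: (@measurable_traj_sum R (fun z => w z.2)).
    exact: measurableT_comp.
  by move=> h; rewrite lee_fin sumr_ge0.
have [ip Ep] := sumE (fun x => Num.max x 0%R) a1 a0 ltac:(exact: measurable_maxr)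
  ltac:(by move=> x; rewrite le_max lexx orbT) a1E a0E.
have [im En] := sumE (fun x => Num.max (- x) 0%R)%R b1 b0
  ltac:(exact: measurable_maxr)
  ltac:(by move=> x; rewrite le_max lexx orbT) b1E b0E.
have incomeE : expected_income N M D mu1 sigma m = (m * u2)%:E.
  rewrite /expected_income unlock.
  transitivity (\int[P]_h ((\sum_(z <- h) Num.max z.2 0%R)%:E -
      (\sum_(z <- h) Num.max (- z.2) 0%R)%:E)).
    apply: eq_integral => h _; rewrite -EFinB -sumrB; congr EFin.
    apply: eq_bigr => z _.
    by case: (leP z.2 0%R) => z0; case: (leP (- z.2) 0)%R => z1; lra.
  rewrite integralB// Ep En -EFinB; congr EFin.
  (* The zero mean of the first action enters as [0 = a0 - b0], multiplied by the expected number
     [u1] of its uses. *)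
  by rewrite mE -[RHS]addr0 -(mulr0 u1) [in RHS]zE; ring.
rewrite /loss incomeE.
transitivity (\int[P]_h ((Num.max 0 m)%:E * (uses1 h)%:R%:E +
    (Num.max 0 (- m))%:E * (uses2 h)%:R%:E)); last by [].
have M0 (x : R) : 0 <= (Num.max 0 x)%:E by rewrite lee_fin le_max lexx.
rewrite ge0_integralD//; first last.
- exact: measurable_funeM.
- by move=> h _; rewrite mule_ge0.
- exact: measurable_funeM.
- by move=> h _; rewrite mule_ge0.
rewrite !ge0_integralZl// U1E U2E -!EFinM -!EFinD -sumU; congr EFin.
case: (leP 0 m)%R => m0.
  by rewrite max_l ?oppr_le0//; ring.
by rewrite max_r ?oppr_ge0 1?ltW//; ring.
Qed.

End loss_formula.

(** * Unnormalized posterior expectations *)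

Section posterior.
Context (R : realType).
Local Notation TR := (measurableTypeR R).
Local Notation mu := (@lebesgue_measure R).
Variables (D : R) (l : R -> R).
Hypothesis D0 : 0 < D.
Hypothesis ml : measurable_fun [set: TR] l.
Hypothesis l0 : forall m, 0 <= l m.
Implicit Types (w : R -> R) (m x X : R) (n : nat).
Local Open Scope ereal_scope.

(** Posterior expectation of [w] up to normalization: [w] is integrated against the prior density
    [l] times the likelihood of [n] incomes with total [X]. The functions [g1] and [g2] are the
    cases where [w] is the positive or the negative part of [m]. *)
Definition posterior w X n : \bar R :=
  \int[mu]_m (w m * expR (D^-1 * (X * m - 2^-1 * n%:R * m ^+ 2)) * l m)%:E.

Lemma posterior_ge0 w X n : (forall m, 0 <= w m)%R -> 0 <= posterior w X n.
Proof.
by move=> w0; apply: integral_ge0 => m _; rewrite lee_fin !mulr_ge0 ?expR_ge0.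
Qed.

Lemma measurable_posterior_integrand d (T : measurableType d) (X n : T -> R) w :
  measurable_fun [set: T] X -> measurable_fun [set: T] n ->
  measurable_fun [set: TR] w ->
  measurable_fun [set: T * TR] (fun z =>
    (w z.2 * expR (D^-1 * (X z.1 * z.2 - 2^-1 * n z.1 * z.2 ^+ 2)) * l z.2)%:E).
Proof.
move=> mX mn mw; apply/measurable_EFinP; apply: measurable_funM; last first.
  exact: measurableT_comp.
apply: measurable_funM; first exact: measurableT_comp.
apply: measurableT_comp => //; apply: measurable_funM => //.
apply: measurable_funB; apply: measurable_funM => //.
- exact: measurableT_comp.
- by apply: measurable_funM => //; exact: measurableT_comp.
- exact: measurable_funX.
Qed.

Lemma measurable_posterior d (T : measurableType d) (X : T -> R) (n : T -> nat) w :
  measurable_fun [set: T] X -> measurable_fun [set: T] (fun t => (n t)%:R : R) ->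
  measurable_fun [set: TR] w -> (forall m, 0 <= w m)%R ->
  measurable_fun [set: T] (fun t => posterior w (X t) (n t)).
Proof.
move=> mX mn mw w0; apply: (measurable_fun_fubini_tonelli_F (m2 := mu) _
  (measurable_posterior_integrand mX mn mw)) => //.
by move=> z; rewrite lee_fin !mulr_ge0 ?expR_ge0.
Qed.

(** After exchanging the integrals, for each fixed [m] the [j] new incomes contribute only a
    likelihood ratio, whose mean under the law with mean 0 is 1. *)
Lemma posterior_martingale w X n j : (0 < j)%N -> measurable_fun [set: TR] w ->
  (forall m, 0 <= w m)%R ->
  \int[normal_prob 0%R (Num.sqrt (j%:R * D))]_x posterior w (X + x)%R (n + j)%N =
  posterior w X n.
Proof.
move=> j0 mw w0; have jR : (0 < j%:R :> R)%R by rewrite ltr0n.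
have V0 : (0 < j%:R * D)%R by exact: mulr_gt0.
pose f (z : TR * TR) :=
  (w z.2 * expR (D^-1 * ((X + z.1) * z.2 - 2^-1 * (n + j)%:R * z.2 ^+ 2)) *
   l z.2)%:E.
have mf : measurable_fun [set: TR * TR] f.
  apply: (@measurable_posterior_integrand _ TR (+%R X) (cst (n + j)%:R)) => //.
  exact: measurable_funD.
have f0 z : 0 <= f z by rewrite lee_fin !mulr_ge0 ?expR_ge0.
apply: (etrans (@fubini_tonelli _ _ _ _ _
  (normal_prob 0%R (Num.sqrt (j%:R * D))) mu f mf f0)).
apply: eq_integral => m _.
pose c := (w m * expR (D^-1 * (X * m - 2^-1 * n%:R * m ^+ 2)) * l m)%R.
(* The sum of [j] incomes has mean [j * m] and variance [j * D]; its likelihood ratio simplifies to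
   [expR (D^-1 * (x * m - j * m ^+ 2 / 2))], the factor by which the integrand changes. *)
pose e x := (expR ((j%:R * D)^-1 * (x * (j%:R * m) - 2^-1 * (j%:R * m) ^+ 2)))%:E.
have me : measurable_fun [set: TR] e.
  apply/measurable_EFinP/measurableT_comp => //; apply: measurable_funM => //.
  by apply: measurable_funB => //; exact: measurable_funM.
have e0 x : 0 <= e x by rewrite lee_fin expR_ge0.
have c0 : 0 <= c%:E by rewrite lee_fin !mulr_ge0 ?expR_ge0.
transitivity (\int[normal_prob 0%R (Num.sqrt (j%:R * D))]_x (c%:E * e x)).
  apply: eq_integral => x _; rewrite /f /c /e/= -EFinM; congr EFin.
  rewrite -!mulrA; congr *%R; rewrite [RHS]mulrCA [LHS]mulrC; congr *%R.
  rewrite -expRD; congr expR; rewrite natrD.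
  by field; rewrite !gt_eqF.
apply: (etrans (ge0_integralZl _ measurableT me (fun x _ => e0 x) c0)).
by rewrite (integral_normal_likelihood _ V0) mule1.
Qed.

Lemma average_trajectory (M : nat) (mu1 : probability TR R) (sigma : strategy R)
    (N : nat) w1 w2 :
  measurable_fun [set: TR] w1 -> measurable_fun [set: TR] w2 ->
  (forall m, 0 <= w1 m)%R -> (forall m, 0 <= w2 m)%R ->
  \int[mu]_m ((\int[trajectory_prob M D mu1 sigma m N]_h
    (w1 m * (uses1 h)%:R + w2 m * (uses2 h)%:R)%:E) * (l m)%:E) =
  \int[trajectory_prob M D mu1 sigma 0%R N]_h
    ((uses1 h)%:R%:E * posterior w1 (income2 h) (uses2 h) +
     (uses2 h)%:R%:E * posterior w2 (income2 h) (uses2 h)).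
Proof.
move=> mw1 mw2 w10 w20; pose P := trajectory_prob M D mu1 sigma 0%R N.
pose q w (z : N.-tuple (bool * TR) * TR) :=
  (w z.2 * expR (D^-1 * (income2 z.1 * z.2 - 2^-1 * (uses2 z.1)%:R * z.2 ^+ 2)) *
   l z.2)%:E.
have mq w : measurable_fun [set: TR] w -> measurable_fun setT (q w).
  move=> mw; apply: (@measurable_posterior_integrand _ _
    (fun h : N.-tuple (bool * TR) => income2 h)
    (fun h : N.-tuple (bool * TR) => (uses2 h)%:R)) => //.
  - exact: measurable_income2.
  - exact: measurable_uses2.
have q0 w z : (forall m, 0 <= w m)%R -> 0 <= q w z.
  by move=> w0; rewrite lee_fin !mulr_ge0 ?expR_ge0.
pose f (z : N.-tuple (bool * TR) * TR) :=
  (uses1 z.1)%:R%:E * q w1 z + (uses2 z.1)%:R%:E * q w2 z.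
have muses1 : measurable_fun setT (fun z : N.-tuple (bool * TR) * TR =>
    (uses1 z.1)%:R%:E : \bar R).
  by apply/measurable_EFinP; exact: measurableT_comp (@measurable_uses1 R N) _.
have muses2 : measurable_fun setT (fun z : N.-tuple (bool * TR) * TR =>
    (uses2 z.1)%:R%:E : \bar R).
  by apply/measurable_EFinP; exact: measurableT_comp (@measurable_uses2 R N) _.
have mf : measurable_fun setT f.
  by apply: emeasurable_funD; apply: emeasurable_funM => //; exact: mq.
have q1 z : 0 <= q w1 z by exact: q0.
have q2 z : 0 <= q w2 z by exact: q0.
have f0 z : 0 <= f z by rewrite /f adde_ge0 ?mule_ge0 ?q1 ?q2 ?lee_fin.
transitivity (\int[mu]_m \int[P]_h f (h, m)).
  apply: eq_integral => m _.
  pose c (h : seq (bool * R)) := (w1 m * (uses1 h)%:R + w2 m * (uses2 h)%:R)%:E.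
  have c0 h : 0 <= c h by rewrite lee_fin addr_ge0// mulr_ge0.
  have mc : measurable_traj c.
    move=> i; apply/measurable_EFinP/measurable_funD; apply: measurable_funM => //.
    - exact: measurable_uses1.
    - exact: measurable_uses2.
  have cE := integral_trajectory_likelihood M mu1 sigma D0 m N mc c0.
  apply: (etrans (congr1 (fun y => y * (l m)%:E) cE)).
  have mLc : measurable_fun setT (fun h : N.-tuple (bool * TR) =>
      (likelihood D m h)%:E * c h).
    by apply: emeasurable_funM; [exact: measurable_likelihood|exact: mc].
  have Lc0 (h : N.-tuple (bool * TR)) : 0 <= (likelihood D m h)%:E * c h.
    by rewrite mule_ge0 ?likelihood_ge0.
  have lm0 : 0 <= (l m)%:E by rewrite lee_fin.
  apply: (etrans
    (esym (ge0_integralZr P measurableT mLc (fun h _ => Lc0 h) lm0))).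
  apply: eq_integral => h _; rewrite /f /q /c /likelihood/= -!EFinM -EFinD.
  by congr EFin; ring.
rewrite -(fubini_tonelli f mf f0); apply: eq_integral => h _.
have mqh w : measurable_fun [set: TR] w ->
    measurable_fun [set: TR] (fun m => q w (h, m)).
  by move=> mw; exact: measurableT_comp (mq w mw) _.
have n0 (n : nat) : 0 <= n%:R%:E :> \bar R by rewrite lee_fin.
have mb (n : nat) w : measurable_fun [set: TR] w ->
    measurable_fun [set: TR] (fun m => n%:R%:E * q w (h, m)).
  by move=> mw; apply: measurable_funeM; exact: mqh.
apply: (etrans (ge0_integralD mu measurableT
  (fun m _ => mule_ge0 (n0 _) (q1 (h, m))) (mb _ w1 mw1)
  (fun m _ => mule_ge0 (n0 _) (q2 (h, m))) (mb _ w2 mw2))).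
congr (_ + _).
- exact: (ge0_integralZl mu measurableT (mqh w1 mw1) (fun m _ => q1 _) (n0 _)).
- exact: (ge0_integralZl mu measurableT (mqh w2 mw2) (fun m _ => q2 _) (n0 _)).
Qed.

End posterior.

Section prior.
Context (R : realType).
Local Notation TR := (measurableTypeR R).
Local Notation mu := (@lebesgue_measure R).
Variables (D C : R) (lambda : R -> R).
Hypothesis D0 : 0 < D.
Hypothesis hlambda : admissible_prior C lambda.
Local Open Scope ereal_scope.

(** The hypotheses constrain [lambda] only on the interval; extension by zero makes it measurable
    and nonnegative on the whole line, as the Tonelli arguments require. *)
Definition prior_density : R -> R := (lambda \_ `[- C, C])%R.

Lemma measurable_prior_density : measurable_fun [set: TR] prior_density.
Proof.
apply: (measurable_restrictT (T1 := TR) (T2 := TR) _ _).1 => //.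
exact: prior_measurable hlambda.
Qed.

Lemma prior_density_ge0 m : (0 <= prior_density m)%R.
Proof.
rewrite /prior_density /patch; case: ifP => // /[1!inE]/=.
by rewrite in_itv/=; exact: prior_ge0 hlambda _.
Qed.

(** The weight [max 0 m] vanishes for negative [m], so integrating over the whole support of the
    prior changes nothing. *)
Lemma g1E X n : g1 D C lambda X n = posterior D prior_density (Num.max 0%R) X n.
Proof.
rewrite /g1 integral_mkcond; apply: eq_integral => m _.
rewrite /prior_density /patch !mem_setE !in_itv/=.
case: (leP 0%R m) => m0 /=; last by rewrite !mul0r.
have -> : (- C <= m <= C)%R = (m <= C)%R.
  by apply: andb_idl => mC; rewrite (le_trans _ m0)// oppr_le0 (le_trans m0).
by case: ifP; rewrite ?mulr0.
Qed.

Lemma g2E X n : g2 D C lambda X n =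
  posterior D prior_density (fun m => Num.max 0 (- m))%R X n.
Proof.
rewrite /g2 integral_mkcond; apply: eq_integral => m _.
rewrite /prior_density /patch !mem_setE !in_itv/=.
case: (leP m 0%R) => m0 /=; last first.
  by rewrite andbF (max_l (x := 0%R)) ?oppr_le0 ?(ltW m0)// !mul0r.
rewrite andbT max_r ?oppr_ge0// ler0_norm//.
have -> : (- C <= m <= C)%R = (- C <= m)%R.
  by apply: andb_idr => mC; rewrite (le_trans m0)// -oppr_le0 (le_trans mC).
by case: ifP; rewrite ?mulr0.
Qed.

Lemma average_loss_trajectory (N M : nat) (mu1 : probability TR R)
    (sigma : strategy R) :
  mu1.-integrable setT (fun x => x%:E) -> 'E_mu1[fun x => x] = 0 ->
  average_loss N M D C mu1 lambda sigma =
  \int[trajectory_prob M D mu1 sigma 0%R N]_h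
    ((uses1 h)%:R%:E * g1 D C lambda (income2 h) (uses2 h) +
     (uses2 h)%:R%:E * g2 D C lambda (income2 h) (uses2 h)).
Proof.
move=> imu1 mean0.
pose w2 m : R := Num.max 0%R (- m)%R.
have mw1 : measurable_fun [set: TR] (Num.max 0%R : R -> R).
  exact: measurable_maxr.
have mw2 : measurable_fun [set: TR] w2 by exact: measurable_maxr.
have w10 m : (0 <= Num.max 0 m :> R)%R by rewrite le_max lexx.
have w20 m : (0 <= w2 m)%R by rewrite le_max lexx.
have avg := average_trajectory D0 measurable_prior_density prior_density_ge0
  M mu1 sigma N mw1 mw2 w10 w20.
transitivity (\int[trajectory_prob M D mu1 sigma 0%R N]_h
    ((uses1 h)%:R%:E *
       posterior D prior_density (Num.max 0%R) (income2 h) (uses2 h) +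
     (uses2 h)%:R%:E * posterior D prior_density w2 (income2 h) (uses2 h))).
  apply: (etrans _ avg); rewrite /average_loss integral_mkcond.
  apply: eq_integral => m _; rewrite /prior_density /patch.
  by case: ifP => _; rewrite ?mule0// loss_trajectory.
by apply: eq_integral => h _; rewrite g1E g2E.
Qed.

End prior.

(** * Dynamic programming *)

Section batch.
Context (R : realType).
Local Notation TR := (measurableTypeR R).
Local Notation history := (seq (bool * R)).
Variables (M : nat) (D : R) (mu1 : probability TR R) (sigma : strategy R).
Hypothesis M0 : (0 < M)%N.
Hypothesis D0 : 0 < D.
Local Open Scope ereal_scope.
Local Notation S := (step_op M D mu1 sigma 0%R).
Local Notation gauss V := (normal_prob 0%R (Num.sqrt V)).
Implicit Types (h : history) (phi : nat -> R -> nat -> \bar R) (psi : R -> \bar R).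

Definition gauss_avg psi (X : R) : \bar R := \int[gauss D]_x psi (X + x)%R.

Lemma measurable_integral_shift (P : probability TR R) psi :
  measurable_fun [set: TR] psi -> (forall x, 0 <= psi x) ->
  measurable_fun [set: TR] (fun X => \int[P]_x psi (X + x)%R).
Proof.
move=> mpsi psi0; pose f (z : TR * TR) := psi (z.1 + z.2)%R.
have mf : measurable_fun [set: TR * TR] f.
  by apply: measurableT_comp => //; exact: measurable_funD.
by apply: (measurable_fun_fubini_tonelli_F (m2 := P) _ mf) => z; exact: psi0.
Qed.

(** At least one average is taken, so that the Gaussian addition formula always meets a positive
    variance. *)
Lemma iter_gauss_avg psi X j : measurable_fun [set: TR] psi ->
  (forall x, 0 <= psi x) ->
  iter j.+1 gauss_avg psi X = \int[gauss (j.+1%:R * D)]_x psi (X + x)%R.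
Proof.
move=> mpsi psi0; elim: j X => [|j ih] X; first by rewrite mul1r.
rewrite iterS {1}/gauss_avg.
have mX : measurable_fun [set: TR] (fun x => psi (X + x)%R).
  by apply: measurableT_comp => //; exact: measurable_funD.
have jD0 : (0 < j.+1%:R * D)%R by rewrite mulr_gt0// ltr0n.
have E : (j.+2%:R * D = D + j.+1%:R * D)%R by rewrite -natr1 mulrDl mul1r addrC.
rewrite E; apply: (etrans _ (ge0_integral_normalD D0 jD0 mX (fun x => psi0 _))).
by apply: eq_integral => x _; rewrite ih; apply: eq_integral => y _; rewrite addrA.
Qed.

Definition boundary h := (M %| uses1 h)%N && (M %| uses2 h)%N.

Lemma step_op_true f h : next_action2 M sigma h = 1%R ->
  S f h = \int[gauss D]_x f ((true, x) :: h).
Proof. by move=> h1; rewrite /step_op h1 subrr mul0e adde0 mul1e. Qed.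

Lemma step_op_false f h : next_action2 M sigma h = 0%R ->
  S f h = \int[mu1]_x f ((false, x) :: h).
Proof. by move=> h0; rewrite /step_op h0 subr0 mul0e add0e mul1e. Qed.

Let uses2_true h (x : R) : uses2 ((true, x) :: h) = (uses2 h).+1.
Proof. by []. Qed.

Let uses1_true h (x : R) : uses1 ((true, x) :: h) = uses1 h.
Proof. by []. Qed.

Let uses2_false h (x : R) : uses2 ((false, x) :: h) = uses2 h.
Proof. by []. Qed.

Let uses1_false h (x : R) : uses1 ((false, x) :: h) = (uses1 h).+1.
Proof. by []. Qed.

(** Inside a batch with [t.+1] steps still to go, the count of the action in use is not a multiple
    of [M], so [next_action2] repeats that action. *)
Let nondvd n t : (t.+1 < M)%N -> (M %| n + t.+1)%N -> (M %| n)%N = false.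
Proof.
move=> tM Mnt; apply/negP => Mn.
by move: Mnt; rewrite (dvdn_addr _ Mn) => /(dvdn_leq (ltn0Sn t)); rewrite leqNgt tM.
Qed.

(** Here [t] counts the steps left in a batch already begun, hence [t < M]; the action at the head
    of [h] is forced until the boundary is reached. *)
Lemma iter_step_op_true f phi t h : (t < M)%N ->
  (forall h, boundary h -> f h = phi (uses1 h) (income2 h) (uses2 h)) ->
  (head (false, 0%R) h).1 -> (M %| uses1 h)%N -> (M %| uses2 h + t)%N ->
  iter t S f h =
  iter t gauss_avg (fun X => phi (uses1 h) X (uses2 h + t)%N) (income2 h).
Proof.
move=> tM fphi; elim: t tM h => [_|t ih tM] h hd M1 M2.
  by rewrite /= fphi ?addn0// /boundary M1 -(addn0 (uses2 h)).
have n1 : next_action2 M sigma h = 1%R.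
  by rewrite /next_action2 (nondvd tM M2) andbF hd.
rewrite [LHS]/= (step_op_true _ n1) [RHS]/=.
have M2' : (M %| (uses2 h).+1 + t)%N by rewrite addSnnS.
apply: eq_integral => x _; rewrite (ih (ltnW tM) ((true, x) :: h) isT M1 M2').
by rewrite income2_cons uses2_true uses1_true addSnnS addrC.
Qed.

Lemma iter_step_op_false f phi t h : (t < M)%N ->
  (forall h, boundary h -> f h = phi (uses1 h) (income2 h) (uses2 h)) ->
  ~~ (head (false, 0%R) h).1 -> (M %| uses1 h + t)%N -> (M %| uses2 h)%N ->
  iter t S f h = phi (uses1 h + t)%N (income2 h) (uses2 h).
Proof.
move=> tM fphi; elim: t tM h => [_|t ih tM] h hd M1 M2.
  by rewrite /= fphi ?addn0// /boundary M2 -(addn0 (uses1 h)) M1.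
have n0 : next_action2 M sigma h = 0%R.
  by rewrite /next_action2 (nondvd tM M1) (negbTE hd).
rewrite [LHS]/= (step_op_false _ n0).
have M1' : (M %| (uses1 h).+1 + t)%N by rewrite addSnnS.
(* An income of the first action leaves [income2] unchanged, so the integrand is constant. *)
transitivity (\int[mu1]_x (cst (phi (uses1 h + t.+1)%N (income2 h) (uses2 h)) x)).
  apply: eq_integral => x _.
  rewrite (ih (ltnW tM) ((false, x) :: h) isT M1' M2).
  by rewrite income2_cons uses1_false uses2_false addSnnS.
exact: integral_probability_cst.
Qed.

Lemma iter_step_op_batch f phi h : 
  (forall k n, measurable_fun [set: TR] (fun X => phi k X n)) ->
  (forall k X n, 0 <= phi k X n) ->
  (forall h, boundary h -> f h = phi (uses1 h) (income2 h) (uses2 h)) ->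
  boundary h ->
  iter M S f h =
  (select2 sigma (uses1 h) (income2 h) (uses2 h))%:E *
    (\int[gauss (M%:R * D)]_x phi (uses1 h) (income2 h + x)%R (uses2 h + M)%N) +
  (1 - select2 sigma (uses1 h) (income2 h) (uses2 h))%:E *
    phi (uses1 h + M)%N (income2 h) (uses2 h).
Proof.
move=> mphi phi0 fphi /[dup] hb /andP[M1 M2].
have nE : next_action2 M sigma h = select2 sigma (uses1 h) (income2 h) (uses2 h).
  by rewrite /next_action2 M1 M2.
have MP : (M.-1.+1 = M)%N by rewrite prednK.
have PM : (M.-1 < M)%N by rewrite MP.
have A1 : \int[income_prob D mu1 0%R true]_x iter M.-1 S f ((true, x) :: h) =
    \int[gauss (M%:R * D)]_x phi (uses1 h) (income2 h + x)%R (uses2 h + M)%N.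
  have := iter_gauss_avg (income2 h) M.-1 (mphi (uses1 h) (uses2 h + M)%N)
    (fun X => phi0 (uses1 h) X (uses2 h + M)%N).
  rewrite iterS MP => E; apply: (etrans _ E); apply: eq_integral => x _.
  have M2' : (M %| (uses2 h).+1 + M.-1)%N by rewrite addSnnS MP dvdn_addr.
  rewrite (iter_step_op_true (h := (true, x) :: h) PM fphi isT M1 M2').
  by rewrite income2_cons uses2_true uses1_true addSnnS MP addrC.
have A2 : \int[income_prob D mu1 0%R false]_x iter M.-1 S f ((false, x) :: h) =
    phi (uses1 h + M)%N (income2 h) (uses2 h).
  apply: (etrans _ (integral_probability_cst mu1 _)).
  have M1' : (M %| (uses1 h).+1 + M.-1)%N by rewrite addSnnS MP dvdn_addr.
  apply: eq_integral => x _.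
  rewrite (iter_step_op_false (h := (false, x) :: h) PM fphi isT M1' M2).
  by rewrite income2_cons uses1_false uses2_false addSnnS MP.
(* The outermost operator is the earliest step, the only one in the batch where a selection is made;
   the other [M.-1] steps were evaluated in [A1] and [A2]. *)
transitivity (S (iter M.-1 S f) h); first by rewrite -iterS MP.
rewrite -nE.
exact: (f_equal2 (fun a b => (next_action2 M sigma h)%:E * a +
  (1 - next_action2 M sigma h)%:E * b) A1 A2).
Qed.

End batch.

(** * Backward induction and the optimal strategy *)

Section dynamic_programming.
Context (R : realType).
Local Notation TR := (measurableTypeR R).
Local Notation history := (seq (bool * R)).
Variables (N M : nat) (D C : R) (lambda : R -> R).
Hypothesis M0 : (0 < M)%N.
Hypothesis MN : (M %| N)%N.
Hypothesis D0 : 0 < D.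
Hypothesis hlambda : admissible_prior C lambda.
Local Open Scope ereal_scope.
Local Notation gauss V := (normal_prob 0%R (Num.sqrt V)).
Local Notation g1 := (g1 D C lambda).
Local Notation g2 := (g2 D C lambda).
Implicit Types (sigma : strategy R) (k n r : nat) (X : R).

Let MD0 : (0 < M%:R * D)%R. Proof. by rewrite mulr_gt0// ltr0n. Qed.

Let max0 (x : R) : (0 <= Num.max 0 x)%R. Proof. by rewrite le_max lexx. Qed.

Let ml := measurable_prior_density hlambda.
Let l0 := prior_density_ge0 hlambda.

Let mmax : measurable_fun [set: TR] (Num.max 0%R : R -> R).
Proof. exact: measurable_maxr. Qed.

Let mmaxN : measurable_fun [set: TR] (fun m => Num.max 0 (- m) : R)%R.
Proof. exact: measurable_maxr. Qed.

Lemma g1_ge0 X n : 0 <= g1 X n.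
Proof. by rewrite g1E; exact: posterior_ge0. Qed.

Lemma g2_ge0 X n : 0 <= g2 X n.
Proof. by rewrite g2E; exact: posterior_ge0. Qed.

Lemma measurable_g1 d (T : measurableType d) (X : T -> R) (n : T -> nat) :
  measurable_fun [set: T] X -> measurable_fun [set: T] (fun t => (n t)%:R : R) ->
  measurable_fun [set: T] (fun t => g1 (X t) (n t)).
Proof.
move=> mX mn; rewrite (_ : (fun _ => _) = (fun t =>
  posterior D (prior_density C lambda) (Num.max 0%R) (X t) (n t))).
  exact: measurable_posterior.
by apply/funext => t; rewrite g1E.
Qed.

Lemma measurable_g2 d (T : measurableType d) (X : T -> R) (n : T -> nat) :
  measurable_fun [set: T] X -> measurable_fun [set: T] (fun t => (n t)%:R : R) ->
  measurable_fun [set: T] (fun t => g2 (X t) (n t)).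
Proof.
move=> mX mn; rewrite (_ : (fun _ => _) = (fun t => posterior D
  (prior_density C lambda) (fun m => Num.max 0 (- m))%R (X t) (n t))).
  exact: measurable_posterior.
by apply/funext => t; rewrite g2E.
Qed.

Lemma g1_martingale X n :
  \int[gauss (M%:R * D)]_x g1 (X + x)%R (n + M)%N = g1 X n.
Proof.
rewrite g1E.
apply: (etrans _ (posterior_martingale D0 ml l0 X n M0 mmax (fun m => max0 m))).
by apply: eq_integral => x _; rewrite g1E.
Qed.

Lemma g2_martingale X n :
  \int[gauss (M%:R * D)]_x g2 (X + x)%R (n + M)%N = g2 X n.
Proof.
rewrite g2E.
apply: (etrans _ (posterior_martingale D0 ml l0 X n M0 mmaxN (fun m => max0 _))).
by apply: eq_integral => x _; rewrite g2E.
Qed.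

Definition accrued_loss k X n : \bar R := k%:R%:E * g1 X n + n%:R%:E * g2 X n.

Let natE0 n : 0 <= n%:R%:E :> \bar R. Proof. by rewrite lee_fin. Qed.

Lemma accrued_loss_ge0 k X n : 0 <= accrued_loss k X n.
Proof. by rewrite adde_ge0// mule_ge0 ?g1_ge0 ?g2_ge0. Qed.

Lemma measurable_accrued_loss k n :
  measurable_fun [set: TR] (fun X => accrued_loss k X n).
Proof.
by apply: emeasurable_funD; apply: measurable_funeM;
  [apply: (@measurable_g1 _ TR id (fun=> n))|
   apply: (@measurable_g2 _ TR id (fun=> n))].
Qed.

(** The argument [r] is the number of batches left. Nothing is charged on the way: the whole cost
    sits in the terminal [accrued_loss], as in the formula for the average loss. *)
Fixpoint strategy_value sigma r k X n : \bar R :=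
  if r is r'.+1 then
    (select2 sigma k X n)%:E *
      (\int[gauss (M%:R * D)]_x strategy_value sigma r' k (X + x)%R (n + M)%N) +
    (1 - select2 sigma k X n)%:E * strategy_value sigma r' (k + M)%N X n
  else accrued_loss k X n.

Let select2_ge0 sigma k X n : 0 <= (select2 sigma k X n)%:E.
Proof. by rewrite lee_fin; case/andP: (select2_bounds sigma k X n). Qed.

Let select1_ge0 sigma k X n : 0 <= (1 - select2 sigma k X n)%:E.
Proof. by rewrite lee_fin subr_ge0; case/andP: (select2_bounds sigma k X n). Qed.

Lemma strategy_value_ge0 sigma r k X n : 0 <= strategy_value sigma r k X n.
Proof.
elim: r k X n => [|r ih] k X n; first exact: accrued_loss_ge0.
by rewrite adde_ge0// mule_ge0// integral_ge0.
Qed.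

Lemma measurable_strategy_value sigma r k n :
  measurable_fun [set: TR] (fun X => strategy_value sigma r k X n).
Proof.
elim: r k n => [|r ih] k n; first exact: measurable_accrued_loss.
apply: emeasurable_funD; apply: emeasurable_funM => //.
- by apply/measurable_EFinP; exact: measurable_select2.
- apply: (@measurable_integral_shift R (gauss (M%:R * D))
    (fun X => strategy_value sigma r k X (n + M))) => // x.
  exact: strategy_value_ge0.
- by apply/measurable_EFinP/measurable_funB => //; exact: measurable_select2.
Qed.

Lemma iter_step_op_value (mu1 : probability TR R) sigma r (h : history) :
  boundary M h ->
  iter (r * M) (step_op M D mu1 sigma 0%R)
    (fun h => accrued_loss (uses1 h) (income2 h) (uses2 h)) h =
  strategy_value sigma r (uses1 h) (income2 h) (uses2 h).
Proof.
elim: r h => [//|r ih] h hb; rewrite mulSn iterD.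
exact: (iter_step_op_batch mu1 sigma M0 D0 (measurable_strategy_value sigma r)
  (strategy_value_ge0 sigma r) ih hb).
Qed.

Lemma average_loss_value (mu1 : probability TR R) sigma :
  mu1.-integrable setT (fun x => x%:E) -> 'E_mu1[fun x => x] = 0 ->
  average_loss N M D C mu1 lambda sigma =
  strategy_value sigma (N %/ M) 0%N 0%R 0%N.
Proof.
move=> imu1 mean0.
apply: (etrans (average_loss_trajectory D0 hlambda N M sigma imu1 mean0)).
pose f (h : history) := accrued_loss (uses1 h) (income2 h) (uses2 h).
have f0 h : 0 <= f h by exact: accrued_loss_ge0.
have mf : measurable_traj f.
  move=> i; apply: emeasurable_funD; apply: emeasurable_funM.
  - by apply/measurable_EFinP; exact: measurable_uses1.
  - by apply: measurable_g1; [exact: measurable_income2|exact: measurable_uses2].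
  - by apply/measurable_EFinP; exact: measurable_uses2.
  - by apply: measurable_g2; [exact: measurable_income2|exact: measurable_uses2].
apply: (etrans (integral_trajectory M D mu1 sigma 0%R N mf f0)).
rewrite -{1}(divnK MN) iter_step_op_value/boundary ?dvdn0//.
by rewrite /income2 big_nil.
Qed.

Variables Rk R1 R2 : nat -> R -> nat -> \bar R.
Hypothesis hdp : dp_equation N M D C lambda Rk R1 R2.

Let convolutionE k n X : measurable_fun [set: TR] (fun X => Rk k X (n + M)%N) ->
  (forall X, 0 <= Rk k X (n + M)%N) ->
  convolution (fun x => Rk k x (n + M)%N) (gauss_pdf (M%:R * D)%R 0%R) X =
  \int[gauss (M%:R * D)]_x Rk k (X + x)%R (n + M)%N.
Proof. by move=> mR R0; rewrite (convolution_gauss_pdf X MD0 mR R0). Qed.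

(** Regularity spreads backwards from the zero terminal values. At each stage the convolution
    becomes a Gaussian expectation only because [Rk] one batch later is already known to be
    measurable and nonnegative. *)
Lemma dp_regular r k n : (M %| k)%N -> (M %| n)%N -> (k + n + r * M = N)%N ->
  [/\ measurable_fun [set: TR] (fun X => R1 k X n),
      measurable_fun [set: TR] (fun X => R2 k X n),
      measurable_fun [set: TR] (fun X => Rk k X n) &
      forall X, 0 <= Rk k X n].
Proof.
move=> Mk Mn knN.
have knN' : (k + n <= N)%N by rewrite -knN leq_addr.
suff [m1 m2 R10 R20] : [/\ measurable_fun [set: TR] (fun X => R1 k X n),
    measurable_fun [set: TR] (fun X => R2 k X n),
    forall X, 0 <= R1 k X n & forall X, 0 <= R2 k X n].
  split => //; last by move=> X; rewrite (dp_min hdp)// le_min R10 R20.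
  rewrite (_ : (fun X => _) = (fun X => mine (R1 k X n) (R2 k X n))).
    exact: measurable_mine.
  by apply/funext => X; exact: (dp_min hdp).
elim: r k n Mk Mn knN knN' => [|r ih] k n Mk Mn knN knN'.
  have z X : R1 k X n = 0 /\ R2 k X n = 0.
    by apply: (dp_final hdp) => //; rewrite -knN mul0n addn0.
  split.
  - by rewrite (_ : (fun X => _) = cst 0)//; apply/funext => X; exact: (z X).1.
  - by rewrite (_ : (fun X => _) = cst 0)//; apply/funext => X; exact: (z X).2.
  - by move=> X; rewrite (z X).1.
  - by move=> X; rewrite (z X).2.
have knN1 : (k + n < N)%N by rewrite -knN mulSn -addnA; lia.
have [Mk' Mn'] : (M %| k + M)%N /\ (M %| n + M)%N by rewrite !dvdn_addl.
have [kN nN] : (k + M + n + r * M = N)%N /\ (k + (n + M) + r * M = N)%N.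
  by split; rewrite -knN mulSn; lia.
have regular k' n' : (M %| k')%N -> (M %| n')%N -> (k' + n' + r * M = N)%N ->
    measurable_fun [set: TR] (fun X => Rk k' X n') /\ forall X, 0 <= Rk k' X n'.
  move=> Mk1 Mn1 kn1; have kn2 : (k' + n' <= N)%N by rewrite -kn1 leq_addr.
  have [m1 m2 R10 R20] := ih k' n' Mk1 Mn1 kn1 kn2; split.
    rewrite (_ : (fun X => _) = (fun X => mine (R1 k' X n') (R2 k' X n'))).
      exact: measurable_mine.
    by apply/funext => X; exact: (dp_min hdp).
  by move=> X; rewrite (dp_min hdp)// le_min R10 R20.
have [mk k0] := regular _ _ Mk' Mn kN.
have [mn n0] := regular _ _ Mk Mn' nN.
have mg1 : measurable_fun [set: TR] (fun X => g1 X n).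
  exact: (@measurable_g1 _ TR id (fun=> n)).
have mg2 : measurable_fun [set: TR] (fun X => g2 X n).
  exact: (@measurable_g2 _ TR id (fun=> n)).
have R1E X : R1 k X n = M%:R%:E * g1 X n + Rk (k + M)%N X n.
  exact: dp_step1 hdp _ _ _ _ _ _.
have R2E X : R2 k X n = M%:R%:E * g2 X n +
    \int[gauss (M%:R * D)]_x Rk k (X + x)%R (n + M)%N.
  by rewrite -convolutionE//; exact: dp_step2 hdp _ _ _ _ _ _.
split.
- rewrite (funext R1E).
  by apply: emeasurable_funD => //; exact: measurable_funeM.
- rewrite (funext R2E).
  apply: emeasurable_funD; first exact: measurable_funeM.
  exact: (@measurable_integral_shift R (gauss (M%:R * D))
    (fun X => Rk k X (n + M)%N)).
- by move=> X; rewrite R1E adde_ge0// mule_ge0// g1_ge0.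
- by move=> X; rewrite R2E adde_ge0// ?integral_ge0// mule_ge0// g2_ge0.
Qed.

(** The summand [M * g_a] in [R_a] is exactly the growth of the accrued loss over a batch of action
    [a]. For the second action the martingale property first brings [g1] and [g2] from [X + x] back
    to [X]. *)
Lemma dp_batch r k n X : (M %| k)%N -> (M %| n)%N -> (k + n + r.+1 * M = N)%N ->
  accrued_loss (k + M)%N X n + Rk (k + M)%N X n =
    accrued_loss k X n + R1 k X n /\
  \int[gauss (M%:R * D)]_x
    (accrued_loss k (X + x)%R (n + M)%N + Rk k (X + x)%R (n + M)%N) =
    accrued_loss k X n + R2 k X n.
Proof.
move=> Mk Mn knN.
have knN1 : (k + n < N)%N by rewrite -knN mulSn -addnA; lia.
have Mn' : (M %| n + M)%N by rewrite dvdn_addl.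
have nN : (k + (n + M) + r * M = N)%N by rewrite -knN mulSn; lia.
have [_ _ mR R0] := dp_regular Mk Mn' nN.
have ndE (g : \bar R) i : 0 <= g ->
    (i + M)%:R%:E * g = i%:R%:E * g + M%:R%:E * g.
  by move=> g0; rewrite natrD EFinD ge0_muleDl.
split.
  rewrite (dp_step1 hdp)// /accrued_loss ndE ?g1_ge0//.
  by rewrite -!addeA; congr (_ + _); rewrite addeCA.
rewrite (dp_step2 hdp)// convolutionE//.
have mX : measurable_fun [set: TR] (fun x => X + x : R)%R.
  exact: measurable_funD.
have mg1 : measurable_fun [set: TR] (fun x => g1 (X + x)%R (n + M)%N).
  exact: (@measurable_g1 _ TR (fun x => X + x)%R (fun=> (n + M)%N)).
have mg2 : measurable_fun [set: TR] (fun x => g2 (X + x)%R (n + M)%N).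
  exact: (@measurable_g2 _ TR (fun x => X + x)%R (fun=> (n + M)%N)).
have mA := measurableT_comp (measurable_accrued_loss k (n + M)) mX.
have mRX := measurableT_comp mR mX.
pose P : probability TR R := gauss (M%:R * D).
have g10 x : 0 <= g1 (X + x)%R (n + M)%N by exact: g1_ge0.
have g20 x : 0 <= g2 (X + x)%R (n + M)%N by exact: g2_ge0.
have accE : \int[P]_x accrued_loss k (X + x)%R (n + M)%N =
    accrued_loss k X n + M%:R%:E * g2 X n.
  transitivity (\int[P]_x (k%:R%:E * g1 (X + x)%R (n + M)%N +
    (n + M)%:R%:E * g2 (X + x)%R (n + M)%N)); first by [].
  apply: (etrans (ge0_integralD P measurableT
    (fun x _ => mule_ge0 (natE0 k) (g10 x)) (measurable_funeM _ mg1)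
    (fun x _ => mule_ge0 (natE0 (n + M)) (g20 x)) (measurable_funeM _ mg2))).
  have I1 := ge0_integralZl P measurableT mg1 (fun x _ => g10 x) (natE0 k).
  have I2 := ge0_integralZl P measurableT mg2 (fun x _ => g20 x) (natE0 (n + M)).
  by rewrite I1 I2 g1_martingale g2_martingale ndE ?g2_ge0// addeA.
rewrite addeA; apply: (etrans (ge0_integralD P measurableT
  (fun x _ => accrued_loss_ge0 k (X + x)%R (n + M)) mA (fun x _ => R0 _) mRX)).
exact: (congr1 (fun y => y + \int[P]_x Rk k (X + x)%R (n + M)%N) accE).
Qed.

Lemma strategy_value_ge sigma r k n X : (M %| k)%N -> (M %| n)%N ->
  (k + n + r * M = N)%N ->
  accrued_loss k X n + Rk k X n <= strategy_value sigma r k X n.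
Proof.
elim: r k n X => [|r ih] k n X Mk Mn knN.
  have [R1z R2z] : R1 k X n = 0 /\ R2 k X n = 0.
    by apply: (dp_final hdp) => //; rewrite -knN mul0n addn0.
  by rewrite (dp_min hdp) -?knN ?leq_addr// R1z R2z minxx adde0.
have [Mk' Mn'] : (M %| k + M)%N /\ (M %| n + M)%N by rewrite !dvdn_addl.
have [kN nN] : (k + M + n + r * M = N)%N /\ (k + (n + M) + r * M = N)%N.
  by split; rewrite -knN mulSn; lia.
have [_ _ mR R0] := dp_regular Mk Mn' nN.
have [E1 E2] := dp_batch X Mk Mn knN.
have mX : measurable_fun [set: TR] (fun x => X + x : R)%R.
  exact: measurable_funD.
set s := (select2 sigma k X n)%:E; set t := (1 - select2 sigma k X n)%:E.
have s0 : 0 <= s by exact: select2_ge0.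
have t0 : 0 <= t by exact: select1_ge0.
have st : s + t = 1 by rewrite -EFinD subrKC.
(* The intermediate term is what [sigma] would cost if it played optimally after the present
   batch. *)
apply: (@le_trans _ _ (s * (accrued_loss k X n + R2 k X n) +
  t * (accrued_loss k X n + R1 k X n))); last first.
  rewrite /= leeD// lee_wpmul2l//; last by rewrite -E1; exact: ih.
  rewrite -E2; apply: ge0_le_integral => //.
  - by move=> x _; rewrite adde_ge0// accrued_loss_ge0.
  - apply: emeasurable_funD.
      exact: measurableT_comp (measurable_accrued_loss k (n + M)) mX.
    exact: measurableT_comp mR mX.
  - exact: measurableT_comp (measurable_strategy_value sigma r k (n + M)) mX.
  - by move=> x _; exact: ih.
have Rk_ge0 : 0 <= Rk k X n by have [_ _ _ ->] := dp_regular Mk Mn knN.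
have G0 : 0 <= accrued_loss k X n + Rk k X n.
  by rewrite adde_ge0// accrued_loss_ge0.
have Rmin : Rk k X n = mine (R1 k X n) (R2 k X n).
  by rewrite (dp_min hdp)// -knN leq_addr.
(* A convex combination of the two options is at least their minimum, so randomizing cannot help. *)
rewrite -[leLHS]mul1e -st ge0_muleDl// leeD// lee_wpmul2l// leeD2l// Rmin.
  by rewrite ge_min lexx orbT.
by rewrite ge_min lexx.
Qed.

(** Off the grid and at the horizon the equation gives no control of how [R1] and [R2] compare, not
    even measurability in [X] off the grid; the guard selects the first action there, which makes
    this a legitimate strategy. Ties also go to the first action. *)
Definition dp_select2 k X n : R :=
  (((M %| k) && (M %| n) && (k + n < N))%N && (R2 k X n < R1 k X n))%:R.

Let dp_select2_bounds k X n : (0 <= dp_select2 k X n <= 1)%R.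
Proof. by rewrite /dp_select2 ler0n lern1 leq_b1. Qed.

Let measurable_dp_select2 k n :
  measurable_fun [set: R] (fun X => dp_select2 k X n).
Proof.
rewrite /dp_select2.
case: (boolP ((M %| k) && (M %| n) && (k + n < N))%N) => [|_]; last first.
  exact: measurable_cst.
move=> /andP[/andP[Mk Mn] knN].
have [r knrN] : exists r, (k + n + r * M = N)%N.
  exists ((N - (k + n)) %/ M)%N; rewrite divnK ?subnKC//; first exact: ltnW.
  by rewrite dvdn_subr ?(ltnW knN)// dvdn_addl.
have [m1 m2 _ _] := dp_regular Mk Mn knrN.
rewrite (_ : (fun X => _) = (fun X => if R2 k X n < R1 k X n then 1%R else 0%R)).
  by apply: measurable_fun_ifT => //; exact: measurable_fun_lte.
by apply/funext => X /=; case: ifP.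
Qed.

Definition dp_strategy : strategy R :=
  Strategy dp_select2_bounds measurable_dp_select2.

Lemma dp_strategy_value r k n X : (M %| k)%N -> (M %| n)%N ->
  (k + n + r * M = N)%N ->
  strategy_value dp_strategy r k X n = accrued_loss k X n + Rk k X n.
Proof.
elim: r k n X => [|r ih] k n X Mk Mn knN.
  have [R1z R2z] : R1 k X n = 0 /\ R2 k X n = 0.
    by apply: (dp_final hdp) => //; rewrite -knN mul0n addn0.
  by rewrite (dp_min hdp) -?knN ?leq_addr// R1z R2z minxx adde0.
have [Mk' Mn'] : (M %| k + M)%N /\ (M %| n + M)%N by rewrite !dvdn_addl.
have [kN nN] : (k + M + n + r * M = N)%N /\ (k + (n + M) + r * M = N)%N.
  by split; rewrite -knN mulSn; lia.
have knN1 : (k + n < N)%N by rewrite -knN mulSn -addnA; lia.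
have [E1 E2] := dp_batch X Mk Mn knN.
rewrite [LHS]/= ih// E1.
transitivity ((dp_select2 k X n)%:E * (accrued_loss k X n + R2 k X n) +
    (1 - dp_select2 k X n)%:E * (accrued_loss k X n + R1 k X n)).
  congr (_ * _ + _); rewrite -E2; apply: eq_integral => x _; exact: ih.
rewrite (dp_min hdp)//; last exact: ltnW.
rewrite /dp_select2 Mk Mn knN1/=; case: ltP => _ /=.
  by rewrite mul1e subrr mul0e adde0.
by rewrite mul0e subr0 mul1e add0e.
Qed.

Lemma dp_bayes_risk (mu1 : probability TR R) :
  mu1.-integrable setT (fun x => x%:E) -> 'E_mu1[fun x => x] = 0 ->
  is_bayes_risk N M D C mu1 lambda (Rk 0%N 0%R 0%N).
Proof.
move=> imu1 mean0.
have NE : (0 + 0 + N %/ M * M = N)%N by rewrite divnK.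
(* Before the first step both counts are zero, so the value of a strategy is compared with [Rk]
   alone. *)
have z : accrued_loss 0 0%R 0 = 0 by rewrite /accrued_loss !mul0e adde0.
split; [exists dp_strategy|move=> sigma].
- rewrite (average_loss_value _ imu1 mean0).
  by rewrite (dp_strategy_value _ (dvdn0 M) (dvdn0 M) NE) z add0e.
- rewrite (average_loss_value _ imu1 mean0) -[leLHS]add0e -z.
  exact: strategy_value_ge.
Qed.

End dynamic_programming.

Theorem theorem2p2 (R : realType) (N M : nat) (D C : R)
  (mu1 : probability (measurableTypeR R) R) (lambda : R -> R)
  (hN : (0 < N)%N) (hM : (0 < M)%N) (hMN : (M %| N)%N)
  (hD : 0 < D) (hC : 0 < C)
  (mu1_integrable : mu1.-integrable setT (fun x => x%:E))
  (mu1_mean0 : ('E_mu1[fun x => x] = 0)%E)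
  (hlambda : admissible_prior C lambda)
  (Rk R1 R2 : nat -> R -> nat -> \bar R)
  (hdp : dp_equation N M D C lambda Rk R1 R2) :
  is_bayes_risk N M D C mu1 lambda (Rk 0%N 0 0%N).
Proof.
exact: (dp_bayes_risk hM hMN hD hlambda hdp mu1_integrable mu1_mean0).
Qed.
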